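(* Let $m$ be a positive integer and let $(K,\partial_0,\dots,\partial_{m-1})$ be a field with $m$ commuting derivations. Let $r$ and $n$ be positive integers, and suppose $K$ has a field extension $K(a_h^{\xi}\colon|\xi|\le 2r\land h<n)$ that meets the differential condition, and such that $|\sigma|\le r$ whenever $a_k^{\sigma}$ is a minimal separable leader. Then $(K,\partial_0,\dots,\partial_{m-1})$ has an extension $(M,D_0,\dots,D_{m-1})$ (a field $M\supseteq K$ with $m$ commuting derivations $D_i$ extending the $\partial_i$) that is compatible with $K(a_h^{\xi}\colon|\xi|<2r\land h<n)$, i.e. $K(a_h^{\xi}\colon|\xi|<2r\land h<n)\subseteq M$ and $D_ia_k^{\sigma}=a_k^{\sigma+\varepsilon_i}$ whenever $i<m$, $k<n$ and $|\sigma|+1<2r$.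
   Context: $n$ denotes also $\{0,\dots,n-1\}$. For $\sigma\in\mathbb{N}^m$, $|\sigma|=\sum_{i<m}\sigma(i)$; $\le$ is the componentwise order on $\mathbb{N}^m$ ($\rho<\sigma$ means $\rho\le\sigma$, $\rho\ne\sigma$); $\varepsilon_i$ is the characteristic function of $\{i\}$ in $\mathbb{N}^m$. The total order $\unlhd$ on $\mathbb{N}^m\times n$: $(\xi,k)\unlhd(\eta,g)$ iff $(|\xi|,k,\xi(0),\dots,\xi(m-2))$ is lexicographically $\le(|\eta|,g,\eta(0),\dots,\eta(m-2))$; $\lhd$ is the strict version. The generators $a_h^\xi$ ($|\xi|\le 2r$, $h<n$) are indexed by an initial segment of this order. The extension meets the differential condition if: whenever $i<m$, $(\sigma+\varepsilon_i,k)$ is among the indices (i.e. $|\sigma|+1\le 2r$), and $f$ is a polynomial over $K$ in variables $(x_h^{\xi}\colon(\xi,h)\unlhd(\sigma,k))$ vanishing at $a=(a_h^{\xi}\colon(\xi,h)\unlhd(\sigma,k))$, then $\sum_{(\eta,g)\unlhd(\sigma,k)}\frac{\partial f}{\partial x_g^{\eta}}(a)\,a_g^{\eta+\varepsilon_i}+f^{\partial_i}(a)=0$, where $f^{\partial_i}$ is $f$ with $\partial_i$ applied to its coefficients. A generator $a_k^{\sigma}$ is a separable leader if it is separably algebraic over $K(a_h^{\xi}\colon(\xi,h)\lhd(\sigma,k))$; it is a minimal separable leader if moreover there is no separable leader $a_k^{\rho}$ with $\rho<\sigma$. *)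

(* Defs.v *)
From HB Require Import structures.
From mathcomp Require Import all_boot all_order all_algebra.
From mathcomp Require Import separable.
From mathcomp Require Import mpoly.
Set Implicit Arguments. Unset Strict Implicit. Unset Printing Implicit Defensive.
Import GRing.Theory.
Local Open Scope ring_scope.

Definition mindex (m : nat) := {ffun 'I_m -> nat}.

Definition msize_idx (m : nat) (xi : mindex m) : nat := (\sum_(i < m) xi i)%N.

Definition add_eps (m : nat) (xi : mindex m) (i : 'I_m) : mindex m :=
  [ffun j => (xi j + (j == i))%N].

Definition mle (m : nat) (rho sigma : mindex m) : bool :=
  [forall i, (rho i <= sigma i)%N].
Definition mlt (m : nat) (rho sigma : mindex m) : bool :=
  mle rho sigma && (rho != sigma).

Fixpoint lexle (s t : seq nat) : bool :=
  match s, t with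
  | [::], _ => true
  | _ :: _, [::] => false
  | x :: s', y :: t' => (x < y)%N || ((x == y) && lexle s' t')
  end.

Definition tri_key (m n : nat) (xi : mindex m) (k : 'I_n) : seq nat :=
  [:: msize_idx xi, nat_of_ord k & [seq xi i | i <- take m.-1 (enum 'I_m)]].

Definition tle (m n : nat) (xi : mindex m) (k : 'I_n) (eta : mindex m) (g : 'I_n) : bool :=
  lexle (tri_key xi k) (tri_key eta g).
Definition tlt (m n : nat) (xi : mindex m) (k : 'I_n) (eta : mindex m) (g : 'I_n) : bool :=
  tle xi k eta g && ((xi, k) != (eta, g)).

Definition derivation (R : nzRingType) (D : R -> R) : Prop :=
  (forall x y, D (x + y) = D x + D y) /\ (forall x y, D (x * y) = D x * y + x * D y).

Definition commuting_derivations (R : nzRingType) (m : nat) (D : 'I_m -> R -> R) : Prop :=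
  (forall i, derivation (D i)) /\ (forall i j x, D i (D j x) = D j (D i x)).

Definition subfield_closed (L : fieldType) (P : L -> Prop) : Prop :=
  [/\ P 0, P 1, (forall x y, P x -> P y -> P (x + y)), (forall x, P x -> P (- x))
    & [/\ (forall x y, P x -> P y -> P (x * y)) & (forall x, P x -> P x^-1)]].

Definition gen_field (K L : fieldType) (iota : K -> L) (S : L -> Prop) (x : L) : Prop :=
  forall P : L -> Prop, subfield_closed P -> (forall c, P (iota c)) ->
    (forall y, S y -> P y) -> P x.

Definition sep_algebraic_over (L : fieldType) (F : L -> Prop) (x : L) : Prop :=
  exists p : {poly L}, [/\ p != 0, forall i, F p`_i, root p x & separable_poly p].

(* Variables x_h^xi of the polynomial rings: indexed by the finite type Var of
   pairs (xi, h) with entries of xi bounded by 2r (which contains every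
   (xi,h) with |xi| <= 2r); encoded in 'I_(nvars m n r). *)
Definition Var (m n r : nat) := ({ffun 'I_m -> 'I_(2 * r).+1} * 'I_n)%type.
Definition nvars (m n r : nat) : nat := #|{: Var m n r}|.
Definition var_idx (m n r : nat) (j : 'I_(nvars m n r)) : Var m n r := enum_val j.
Definition var_xi (m n r : nat) (j : 'I_(nvars m n r)) : mindex m :=
  [ffun i => nat_of_ord ((var_idx j).1 i)].
Definition var_h (m n r : nat) (j : 'I_(nvars m n r)) : 'I_n := (var_idx j).2.

Definition vars_in (R : nzRingType) (N : nat) (f : {mpoly R[N]}) (P : 'I_N -> bool) : Prop :=
  forall mo, mo \in msupp f -> forall j, (0 < mo j)%N -> P j.

Section Ext.
Variables (K L : fieldType) (m n r : nat) (d : 'I_m -> K -> K)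
  (iota : {rmorphism K -> L}) (a : mindex m -> 'I_n -> L).

Definition apoint (j : 'I_(nvars m n r)) : L := a (var_xi j) (var_h j).

Definition differential_condition : Prop :=
  forall (i : 'I_m) (sigma : mindex m) (k : 'I_n),
    (msize_idx sigma + 1 <= 2 * r)%N ->
    forall f : {mpoly K[nvars m n r]},
      vars_in f (fun j => tle (var_xi j) (var_h j) sigma k) ->
      (map_mpoly iota f).@[apoint] = 0 ->
      \sum_(j < nvars m n r | tle (var_xi j) (var_h j) sigma k)
          (map_mpoly iota (mderiv j f)).@[apoint] * a (add_eps (var_xi j) i) (var_h j)
      + (map_mpoly iota (map_mpoly (d i) f)).@[apoint] = 0.

Definition sep_leader (sigma : mindex m) (k : 'I_n) : Prop :=
  sep_algebraic_over
    (gen_field iota (fun y => exists xi h, [/\ (msize_idx xi <= 2 * r)%N,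
                                             tlt xi h sigma k & y = a xi h]))
    (a sigma k).

Definition min_sep_leader (sigma : mindex m) (k : 'I_n) : Prop :=
  sep_leader sigma k /\ ~ (exists rho, mlt rho sigma /\ sep_leader rho k).

Definition low_field : L -> Prop :=
  gen_field iota (fun y => exists xi h, (msize_idx xi < 2 * r)%N /\ y = a xi h).

End Ext.

(* Main.v *)
Require Import Defs.
From HB Require Import structures.
From mathcomp Require Import all_boot all_order all_algebra.
From mathcomp Require Import separable.
From mathcomp Require Import mpoly.
From mathcomp Require Import ring zify.
From mathcomp Require Import boolp.
Import GRing.Theory.
Local Open Scope ring_scope.
Set Implicit Arguments.
Unset Strict Implicit.
Unset Printing Implicit Defensive.

(* The differential condition says that each [D_i] is a well-defined derivation on the
   field generated by an initial segment of the generators, so new generators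
   [b_k^tau] are adjoined one at a time, following the order [tle], inside one large
   field [E] of infinite transcendence degree over [L].  If some [tau - eps_i] is a
   separable leader, then [b^tau] has to be [D_i b^(tau - eps_i)], which already lies in the
   field generated so far; otherwise [b^tau] is taken transcendental.  When both
   [tau - eps_i] and [tau - eps_j] are separable leaders the two values must agree.  If
   [tau - eps_i - eps_j] is one too, they do, since the commutator [D_i, D_j] is a derivation
   vanishing on everything below it.  In general pick minimal leaders [rho <= tau - eps_i] and
   [rho' <= tau - eps_j]: their join has size at most [2r < |tau|], so it lies below some
   [tau - eps_k], and the values at [i] and [j] are compared through the value at [k].
   At [|tau| = 2r] the given [a^tau] cannot be kept, as it might be inseparable over the
   previous generators; there the differential condition is a system of affine equations
   over [K(a^xi : |xi| < 2r)] which has the solution [a], and [b] is a generic solution. *)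

(** * A field with an infinite tower of transcendental elements *)

Fixpoint tower (L : fieldType) (t : nat) : fieldType :=
  if t is t'.+1 then {fraction {poly (tower L t')}} else L.

Definition tower_up (L : fieldType) (t : nat) :
    {rmorphism tower L t -> tower L t.+1} := @tofrac _ \o polyC.

Section DirectLimit.
Variable L : fieldType.

(** The union of the tower is built as a quotient: eventually coherent threads modulo those that are
    eventually zero. This avoids casts between the stages, which are different types. *)
Definition thread := forall t, tower L t.
HB.instance Definition _ := Choice.on thread.

Definition thread_add (f g : thread) : thread := fun t => f t + g t.
Definition thread_opp (f : thread) : thread := fun t => - f t.
Definition thread_mul (f g : thread) : thread := fun t => f t * g t.

Fact thread_addA : associative thread_add.
Proof. by move=> f g h; apply: functional_extensionality_dep => t; apply: addrA. Qed.
Fact thread_addC : commutative thread_add.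
Proof. by move=> f g; apply: functional_extensionality_dep => t; apply: addrC. Qed.
Fact thread_add0 : left_id (fun=> 0) thread_add.
Proof. by move=> f; apply: functional_extensionality_dep => t; apply: add0r. Qed.
Fact thread_addN : left_inverse (fun=> 0) thread_opp thread_add.
Proof. by move=> f; apply: functional_extensionality_dep => t; apply: addNr. Qed.
HB.instance Definition _ :=
  GRing.isZmodule.Build thread thread_addA thread_addC thread_add0 thread_addN.

Fact thread_mulA : associative thread_mul.
Proof. by move=> f g h; apply: functional_extensionality_dep => t; apply: mulrA. Qed.
Fact thread_mulC : commutative thread_mul.
Proof. by move=> f g; apply: functional_extensionality_dep => t; apply: mulrC. Qed.
Fact thread_mul1 : left_id ((fun=> 1) : thread) thread_mul.
Proof. by move=> f; apply: functional_extensionality_dep => t; apply: mul1r. Qed.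
Fact thread_mulD : left_distributive thread_mul +%R.
Proof. by move=> f g h; apply: functional_extensionality_dep => t; apply: mulrDl. Qed.
Fact thread_1neq0 : ((fun=> 1) : thread) != 0.
Proof. by apply/eqP => /(congr1 (fun f : thread => f 0%N)) /eqP; rewrite oner_eq0. Qed.
HB.instance Definition _ := GRing.Zmodule_isComNzRing.Build thread
  thread_mulA thread_mulC thread_mul1 thread_mulD thread_1neq0.

Definition coherent_from (t0 : nat) (f : thread) : Prop :=
  forall t, (t0 <= t)%N -> f t.+1 = tower_up L t (f t).

Definition coherent : {pred thread} := fun f => `[< exists t0, coherent_from t0 f >].

Lemma coherent_fromW s t f : (s <= t)%N -> coherent_from s f -> coherent_from t f.
Proof. by move=> st cf u tu; apply/cf/(leq_trans st). Qed.

Fact coherent_subring : subring_closed coherent.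
Proof.
split=> [|f g /asboolP[s cf] /asboolP[t cg]|f g /asboolP[s cf] /asboolP[t cg]].
- by apply/asboolP; exists 0%N => t _; rewrite rmorph1.
- apply/asboolP; exists (maxn s t) => u; rewrite geq_max => /andP[su tu].
  by rewrite rmorphB -cf // -cg.
apply/asboolP; exists (maxn s t) => u; rewrite geq_max => /andP[su tu].
by rewrite rmorphM -cf // -cg.
Qed.
HB.instance Definition _ := GRing.isSubringClosed.Build thread coherent coherent_subring.

Record germ := Germ { germ_val :> thread; _ : germ_val \in coherent }.
HB.instance Definition _ := [isSub for germ_val].
HB.instance Definition _ := [Choice of germ by <:].
HB.instance Definition _ := [SubChoice_isSubComNzRing of germ by <:].

Definition negligible : {pred germ} :=
  fun f => `[< exists t0, forall t, (t0 <= t)%N -> val f t = 0 >].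

(** The maps [tower_up] are field embeddings, so from [t] on a coherent thread vanishes everywhere
    or nowhere. One stage thus decides membership in [negligible]. *)
Lemma coherent_from_eq0 t (f : thread) s : coherent_from t f -> (t <= s)%N ->
  (f s == 0) = (f t == 0).
Proof.
move=> cf; elim: s => [|s IHs]; first by rewrite leqn0 => /eqP->.
rewrite leq_eqVlt => /predU1P[->//|]; rewrite ltnS => ts.
by rewrite cf // fmorph_eq0 IHs.
Qed.

Lemma negligibleP t (f : germ) : coherent_from t f -> reflect (val f t = 0) (f \in negligible).
Proof.
move=> cf; apply: (iffP (asboolP _)) => [[s fs]|ft].
  apply/eqP; rewrite -(coherent_from_eq0 cf (leq_maxr s t)).
  by rewrite fs // leq_maxl.
by exists t => s ts; apply/eqP; rewrite (coherent_from_eq0 cf) // ft.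
Qed.

Fact negligible_ideal : idealr_closed negligible.
Proof.
split=> [|| c f g /asboolP[s f0] /asboolP[t g0]].
- by apply/asboolP; exists 0%N.
- by apply/asboolP => -[t /(_ t (leqnn t))] /eqP; rewrite [_ == _]oner_eq0.
apply/asboolP; exists (maxn s t) => u; rewrite geq_max => /andP[su tu].
have -> : val (c * f + g) u = val c u * val f u + val g u by [].
by rewrite f0 // g0 // mulr0 addr0.
Qed.
HB.instance Definition _ := isIdealr.Build germ negligible negligible_ideal.

Lemma germ_coherent (f : germ) : exists t, coherent_from t f.
Proof. exact: (asboolW (valP f)). Qed.

Definition limit := {ideal_quot negligible}.
HB.instance Definition _ := GRing.ComNzRing.on limit.

Definition germ_class : {rmorphism germ -> limit} := \pi_limit%qT.

Lemma germ_class_eq0 t (f : germ) : coherent_from t f ->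
  (germ_class f == 0) = (val f t == 0).
Proof.
move=> cf; rewrite -[0 in LHS](rmorph0 germ_class) /=.
rewrite -[LHS](Quotient.idealrBE negligible) subr0.
by apply/(negligibleP cf)/eqP.
Qed.

Lemma germ_inv_subproof t (f : germ) : coherent_from t f ->
  (fun s => (val f s)^-1) \in coherent.
Proof. by move=> cf; apply/asboolP; exists t => s ts; rewrite -[RHS]/(tower_up L s (val f s)^-1) fmorphV -cf. Qed.

Lemma germ_class_unit t (f : germ) (cf : coherent_from t f) : germ_class f != 0 ->
  germ_class (Germ (germ_inv_subproof cf)) * germ_class f = 1.
Proof.
rewrite (germ_class_eq0 cf) => f0; apply/eqP; rewrite -rmorphM -subr_eq0.
rewrite -(rmorph1 germ_class) -rmorphB; set g := (X in germ_class X).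
have cg : coherent_from t g.
  move=> s ts; rewrite -[RHS]/(tower_up L s ((val f s)^-1 * val f s - 1)).
  by rewrite rmorphB rmorphM rmorph1 fmorphV -cf.
rewrite (germ_class_eq0 cg) -[val g t]/((val f t)^-1 * val f t - 1).
by rewrite mulVf // subrr.
Qed.

Lemma germ_class_surj (y : limit) : exists t (f : germ), coherent_from t f /\ y = germ_class f.
Proof.
have [t cf] := germ_coherent (repr y); exists t, (repr y); split=> //.
by rewrite /germ_class /= reprK.
Qed.

Lemma limit_inv_ex (y : limit) : exists z : limit, (y != 0 -> z * y = 1) /\ (y = 0 -> z = 0).
Proof.
have [->|y0] := eqVneq y 0; first by exists 0.
have [t [f [cf yf]]] := germ_class_surj y.
exists (germ_class (Germ (germ_inv_subproof cf))); split=> [_|y0']; last by rewrite y0' eqxx in y0.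
by rewrite yf germ_class_unit // -yf.
Qed.

Definition limit_inv (y : limit) : limit := projT1 (cid (limit_inv_ex y)).
Fact limit_mulV y : y != 0 -> limit_inv y * y = 1.
Proof. by move=> y0; rewrite /limit_inv; case: cid => z /= [-> ]. Qed.
Fact limit_inv0 : limit_inv 0 = 0.
Proof. by rewrite /limit_inv; case: cid => z /= [_ ->]. Qed.
HB.instance Definition _ := GRing.ComNzRing_isField.Build limit limit_mulV limit_inv0.

(** The copy of [tower L t] inside the limit: up to a negligible germ, [f] is determined by its
    entry at stage [t]. *)
Definition limit_stage (t : nat) : limit -> Prop :=
  fun y => exists f : germ, coherent_from t f /\ y = germ_class f.

Lemma limit_stage_closed t : subfield_closed (limit_stage t).
Proof.
split; [| | | |split].
- by exists 0; split; [move=> s _; rewrite rmorph0|rewrite rmorph0].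
- by exists 1; split; [move=> s _; rewrite rmorph1|rewrite rmorph1].
- move=> _ _ [f [cf ->]] [g [cg ->]]; exists (f + g); split; last by rewrite rmorphD.
  by move=> s ts; rewrite -[RHS]/(tower_up L s (val f s + val g s)) rmorphD -cf // -cg.
- move=> _ [f [cf ->]]; exists (- f); split; last by rewrite rmorphN.
  by move=> s ts; rewrite -[RHS]/(tower_up L s (- val f s)) rmorphN -cf.
- move=> _ _ [f [cf ->]] [g [cg ->]]; exists (f * g); split; last by rewrite rmorphM.
  by move=> s ts; rewrite -[RHS]/(tower_up L s (val f s * val g s)) rmorphM -cf // -cg.
move=> _ [f [cf ->]]; have [->|f0] := eqVneq (germ_class f) 0.
  by exists 0; split; [move=> s _; rewrite rmorph0|rewrite rmorph0 invr0].
exists (Germ (germ_inv_subproof cf)); split.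
  by move=> s ts; rewrite /= -[RHS]/(tower_up L s (val f s)^-1) fmorphV -cf.
by apply: (mulIf f0); rewrite mulVf // germ_class_unit.
Qed.

Lemma limit_stageW s t y : (s <= t)%N -> limit_stage s y -> limit_stage t y.
Proof. by move=> st [f [cf ->]]; exists f; split=> //; apply: coherent_fromW cf. Qed.

Fixpoint base_thread (c : L) (t : nat) : tower L t :=
  if t is t'.+1 then tower_up L t' (base_thread c t') else c.

Fact base_thread_coherent c : base_thread c \in coherent.
Proof. by apply/asboolP; exists 0%N. Qed.
Definition base_germ c := Germ (base_thread_coherent c).

Fact base_germ_zmod : zmod_morphism base_germ.
Proof.
move=> c e; apply/val_inj/functional_extensionality_dep; elim=> [|t IHt] //.
by rewrite -[LHS]/(tower_up L t (val (base_germ (c - e)) t)) IHt -[RHS]rmorphB.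
Qed.
Fact base_germ_monoid : monoid_morphism base_germ.
Proof.
split=> [|c e]; apply/val_inj/functional_extensionality_dep; elim=> [|t IHt] //.
  by rewrite -[LHS]/(tower_up L t (val (base_germ 1) t)) IHt -[RHS](rmorph1 (tower_up L t)).
by rewrite -[LHS]/(tower_up L t (val (base_germ (c * e)) t)) IHt -[RHS]rmorphM.
Qed.
HB.instance Definition _ := GRing.isZmodMorphism.Build L germ base_germ base_germ_zmod.
HB.instance Definition _ := GRing.isMonoidMorphism.Build L germ base_germ base_germ_monoid.

(** The variable that enters at stage [t0.+1]; up to stage [t0], where it does not exist yet, the
    entries are the placeholder 0. *)
Fixpoint var_thread (t0 t : nat) : tower L t :=
  if t is t'.+1 then
    if t' == t0 then tofrac 'X else tower_up L t' (var_thread t0 t')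
  else 0.

Lemma coherent_from_var t : coherent_from t.+1 (var_thread t).
Proof. by move=> s ts /=; rewrite gtn_eqF. Qed.

Fact var_thread_coherent t : var_thread t \in coherent.
Proof. by apply/asboolP; exists t.+1; apply: coherent_from_var. Qed.
Definition var_germ t := Germ (var_thread_coherent t).

End DirectLimit.

Definition transcendental_over (E : fieldType) (F : E -> Prop) (u : E) : Prop :=
  forall p : {poly E}, (forall i, F p`_i) -> root p u -> p = 0.

(** At stage [t.+1] the value of [p] becomes a polynomial in ['X] whose coefficients are the entries
    at stage [t] of germs representing those of [p]. It vanishes in the fraction field only if all
    these entries do. *)
Lemma var_germ_transcendental (L : fieldType) t :
  transcendental_over (limit_stage t) (germ_class L (var_germ L t)).
Proof.
move=> p /choice[c cP] /rootP.
have cc i : coherent_from t (c i) by case: (cP i).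
set x := var_germ L t; pose q := \sum_(i < size p) c i * x ^+ i.
have -> : p.[germ_class L x] = germ_class L q.
  rewrite horner_coef rmorph_sum; apply: eq_bigr => i _.
  by rewrite rmorphM rmorphXn; case: (cP i) => _ <-.
have qE s : val q s = \sum_(i < size p) val (c i) s * val x s ^+ i.
  rewrite /q; elim/big_ind2: _ => [|u1 u2 v1 v2 <- <-|i _] //.
  rewrite -[LHS]/(val (c i) s * val (x ^+ i) s); congr (_ * _).
  by elim: (val i) => [|k IHk] //; rewrite !exprS -IHk.
have cq : coherent_from t.+1 q.
  move=> s ts; rewrite !qE rmorph_sum; apply: eq_bigr => i _.
  by rewrite rmorphM rmorphXn -(cc i s (ltnW ts)) -(coherent_from_var _ ts).
move/eqP; rewrite (germ_class_eq0 cq) qE.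
have cX i : val (c i) t.+1 * val x t.+1 ^+ i = tofrac ((val (c i) t)%:P * 'X^i).
  by rewrite rmorphM rmorphXn /= eqxx; congr (_ * _); apply: cc.
under eq_bigr do rewrite cX.
rewrite -rmorph_sum tofrac_eq0 => /eqP q0.
apply/polyP => i; rewrite coef0; case: (ltnP i (size p)) => [ip|/leq_sizeP-> //].
case: (cP i) => _ ->; apply/eqP; rewrite (germ_class_eq0 (cc i)); apply/eqP.
move/(congr1 (fun r : {poly _} => r`_i)): q0; rewrite coef0 coef_sum.
rewrite (bigD1 (Ordinal ip)) //= coefCM coefXn eqxx mulr1 big1 ?addr0 // => j ji.
by rewrite coefCM coefXn eq_sym (negPf (ji : val j != val (Ordinal ip))) mulr0.
Qed.

(** Supplies a fresh element [x t] for each position [t] of the later construction; the values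
    chosen at positions below [t] will stay inside [P t]. *)
Lemma exists_transcendence_tower (L : fieldType) :
  exists (E : fieldType) (j : {rmorphism L -> E}) (P : nat -> E -> Prop) (x : nat -> E),
    [/\ forall t, subfield_closed (P t),
        forall s t y, (s <= t)%N -> P s y -> P t y,
        forall y, P 0%N (j y),
        forall t, P t.+1 (x t) &
        forall t, transcendental_over (P t) (x t)].
Proof.
exists (limit L), (germ_class L \o @base_germ L), (@limit_stage L), (germ_class L \o var_germ L).
split; [exact: limit_stage_closed|exact: limit_stageW| | |exact: var_germ_transcendental].
  by move=> y; exists (base_germ y).
by move=> t; exists (var_germ L t); split; first exact: coherent_from_var.
Qed.

(** * Derivations as fields of dual numbers *)

Section SubfieldClosed.
Variables (E : fieldType) (P : E -> Prop).
Hypothesis Pf : subfield_closed P.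

Lemma subfield_sum (I : Type) (s : seq I) (Q : pred I) (f : I -> E) :
  (forall i, Q i -> P (f i)) -> P (\sum_(i <- s | Q i) f i).
Proof. by case: Pf => P0 _ PD _ _ Pi; elim/big_ind: _. Qed.

Lemma subfield_horner (p : {poly E}) u : (forall i, P p`_i) -> P u -> P p.[u].
Proof.
case: Pf => P0 P1 _ _ [PM _] Pp Pu; rewrite horner_coef; apply: subfield_sum => i _.
apply: (PM) => //; elim: (val i) => [|k IHk]; first by rewrite expr0.
by rewrite exprS; apply: PM.
Qed.

Lemma subfield_natmul y k : P y -> P (y *+ k).
Proof. by case: Pf => P0 _ PD _ _ Py; elim: k => // k IHk; rewrite mulrS; apply: PD. Qed.

Lemma subfield_sep_algebraic u : P u -> sep_algebraic_over P u.
Proof.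
case: Pf => P0 P1 _ PN _ Pu; exists ('X - u%:P); split.
- by rewrite polyXsubC_eq0.
- by move=> i; rewrite coefB coefX coefC; case: i => [|[|i]] /=; rewrite ?sub0r ?subr0; try exact: PN.
- by rewrite root_XsubC.
by rewrite separable_poly.unlock derivXsubC coprimep1.
Qed.

End SubfieldClosed.

Lemma sep_algebraic_deriv (E : fieldType) (p : {poly E}) u :
  separable_poly p -> root p u -> p^`().[u] != 0.
Proof. by rewrite separable_poly.unlock => /coprimep_root; apply. Qed.

Lemma sep_algebraic_map (E E' : fieldType) (j : {rmorphism E -> E'})
    (F : E -> Prop) (F' : E' -> Prop) u :
  (forall y, F y -> F' (j y)) -> sep_algebraic_over F u -> sep_algebraic_over F' (j u).
Proof.
move=> FF' [p [p0 Fp pu sp]]; exists (map_poly j p); split.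
- by rewrite map_poly_eq0.
- by move=> i; rewrite coef_map; apply: FF'.
- by rewrite rmorph_root.
by rewrite separable_map.
Qed.

Lemma sep_algebraic_not_transcendental (E : fieldType) (F : E -> Prop) u :
  sep_algebraic_over F u -> ~ transcendental_over F u.
Proof. by case=> p [/eqP p0 Fp pu _] /(_ p Fp pu). Qed.

Lemma transcendental_overW (E : fieldType) (F F' : E -> Prop) u :
  (forall y, F' y -> F y) -> transcendental_over F u -> transcendental_over F' u.
Proof. by move=> F'F Fu p F'p; apply: Fu => i; apply/F'F/F'p. Qed.

(* A relation [R y z] is read as a set of dual numbers [y + z eps]: the graph of a
   derivation on a subfield is a subfield of dual numbers meeting [E eps] in 0. *)
Section DualNumbers.
Variable E : fieldType.
Implicit Types (R G : E -> E -> Prop) (p q : {poly E}).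

Definition dual_ring R : Prop :=
  [/\ R 1 0,
      forall y z y' z', R y z -> R y' z' -> R (y + y') (z + z'),
      forall y z, R y z -> R (- y) (- z) &
      forall y z y' z', R y z -> R y' z' -> R (y * y') (z * y' + y * z')].

(** The inverse of [y + z eps] is [y^-1 - z y^-2 eps]. With the convention [0^-1 = 0], the clause at
    [y = 0] only yields the pair [(0, 0)]. *)
Definition dual_field R : Prop :=
  dual_ring R /\ forall y z, R y z -> R y^-1 (- z * y^-1 * y^-1).

Definition functional R : Prop := forall z, R 0 z -> z = 0.

Definition dual_closure G : E -> E -> Prop := fun y z =>
  forall R, dual_field R -> (forall y' z', G y' z' -> R y' z') -> R y z.

Definition dual_dom R : E -> Prop := fun y => exists z, R y z.

Lemma dual_closure_field G : dual_field (dual_closure G).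
Proof.
split; [split|].
- by move=> R [[R1 _ _ _] _] _.
- by move=> y z y' z' yz yz' R Rf GR; case: (Rf) => [[_ RD _ _] _]; apply: RD; [apply: yz|apply: yz'].
- by move=> y z yz R Rf GR; case: (Rf) => [[_ _ RN _] _]; apply: RN; apply: yz.
- by move=> y z y' z' yz yz' R Rf GR; case: (Rf) => [[_ _ _ RM] _]; apply: RM; [apply: yz|apply: yz'].
by move=> y z yz R Rf GR; case: (Rf) => [_ RV]; apply: RV; apply: yz.
Qed.

Lemma dual_closure_gen G y z : G y z -> dual_closure G y z.
Proof. by move=> Gyz R _; apply. Qed.

Lemma dual_closure_le G R : dual_field R -> (forall y z, G y z -> R y z) ->
  forall y z, dual_closure G y z -> R y z.
Proof. by move=> Rf GR y z; apply. Qed.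

Lemma dual_closure_mono G G' : (forall y z, G y z -> G' y z) ->
  forall y z, dual_closure G y z -> dual_closure G' y z.
Proof.
by move=> GG'; apply: dual_closure_le => [|y z /GG'/dual_closure_gen //]; apply: dual_closure_field.
Qed.

Lemma dual_closure_range G (P : E -> Prop) : subfield_closed P ->
  (forall y z, G y z -> P y /\ P z) -> forall y z, dual_closure G y z -> P y /\ P z.
Proof.
move=> [P0 P1 PD PN [PM PV]] GP y z.
apply: (@dual_closure_le G (fun y z => P y /\ P z)) => //; split; [split|] => //.
- by move=> a b c d [? ?] [? ?]; split; apply: PD.
- by move=> a b [? ?]; split; apply: PN.
- by move=> a b c d [? ?] [? ?]; split; [|apply: PD]; apply: PM.
move=> a b [Pa Pb]; split; first exact: PV.
by apply: (PM); [apply: (PM); [apply: PN|apply: PV]|apply: PV].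
Qed.

Lemma dual_closure_domP G (P : E -> Prop) : subfield_closed P ->
  (forall y z, G y z -> P y) -> forall y z, dual_closure G y z -> P y.
Proof.
move=> [P0 P1 PD PN [PM PV]] GP y z.
apply: (@dual_closure_le G (fun y z => P y)) => //; split; [split|] => // a b.
- by move=> c d ? ?; apply: PD.
- by move=> ?; apply: PN.
- by move=> c d ? ?; apply: PM.
by move=> ?; apply: PV.
Qed.

Section Ring.
Variable R : E -> E -> Prop.
Hypothesis Rr : dual_ring R.

Lemma dual00 : R 0 0.
Proof. by case: Rr => R1 RD RN _; have := RD _ _ _ _ R1 (RN _ _ R1); rewrite !subrr. Qed.

Lemma dual_sum (I : Type) (s : seq I) (Q : pred I) (f g : I -> E) :
  (forall i, Q i -> R (f i) (g i)) -> R (\sum_(i <- s | Q i) f i) (\sum_(i <- s | Q i) g i).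
Proof. by move=> H; apply: (big_ind2 R) => //; [exact: dual00|case: Rr]. Qed.

Lemma dual_functional y z z' : functional R -> R y z -> R y z' -> z = z'.
Proof.
case: Rr => _ RD RN _ Rf yz /RN yz'; apply/eqP; rewrite -subr_eq0; apply/eqP/Rf.
by rewrite -(subrr y); apply: RD.
Qed.

(** The chain rule [D(p(u)) = p^D(u) + p'(u) D(u)], where [q] is any choice of derivatives for the
    coefficients of [p], since [R] may be multivalued. *)
Lemma dual_horner p q u v : (forall i, R p`_i q`_i) -> R u v ->
  R p.[u] (q.[u] + p^`().[u] * v).
Proof.
case: (Rr) => R1 RD _ RM + Ruv; elim/poly_ind: p q => [|p c IHp] q Rpq.
  (* For [p = 0] the polynomial [q] can still be nonzero, with [R 0 q_k]; multiplying by a pair for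
     [u ^+ k] gives [R 0 (q_k * u ^+ k)]. *)
  have expu k : exists w, R (u ^+ k) w.
    elim: k => [|k [w IHk]]; first by exists 0; rewrite expr0.
    by exists (v * u ^+ k + u * w); rewrite exprS; apply: RM.
  rewrite deriv0 !horner0 mul0r addr0 horner_coef.
  suff: R (\sum_(i < size q) 0) (\sum_(i < size q) q`_i * u ^+ i) by rewrite big1.
  apply: dual_sum => i _; have [w Rw] := expu i.
  by have := RM _ _ _ _ (Rpq i) Rw; rewrite coef0 !mul0r addr0.
pose q1 := Poly (behead q).
have qE : q = q1 * 'X + (q`_0)%:P.
  apply/polyP => -[|i]; rewrite coefD coefMX coefC /= ?add0r ?addr0 //.
  by rewrite coef_Poly nth_behead.
have Rpq1 i : R p`_i q1`_i.
  by have := Rpq i.+1; rewrite coefD coefMX coefC /= addr0 coef_Poly nth_behead.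
have Rc : R c q`_0 by have := Rpq 0%N; rewrite coefD coefMX coefC /= add0r.
rewrite {1}qE derivD derivC addr0 derivM derivX mulr1 !hornerE.
have := RD _ _ _ _ (RM _ _ _ _ (IHp _ Rpq1) Ruv) Rc.
by congr R; ring.
Qed.

End Ring.

(** Differentiating [p(u) = 0] gives [p^D(u) + p'(u) v = 0], and [p'(u)] is nonzero by separability.
    Hence [v] is a rational expression in [u], the coefficients of [p] and their derivatives. *)
Lemma sep_algebraic_value R (F P : E -> Prop) u v : dual_ring R -> functional R ->
  subfield_closed P -> (forall y, F y -> P y /\ exists2 z, R y z & P z) ->
  sep_algebraic_over F u -> P u -> R u v -> P v.
Proof.
move=> Rr Rf Pf FP [p [_ Fp /rootP pu sp]] Pu Ruv.
have /choice[q qP] i : exists z, R p`_i z /\ P z by have [_ [z]] := FP _ (Fp i); exists z.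
pose q' := \poly_(i < size p) q i.
have Rpq i : R p`_i q'`_i.
  by rewrite coef_poly; case: ltnP => ?; [case: (qP i)|rewrite nth_default //; apply: dual00].
have Pq i : P q'`_i.
  by rewrite coef_poly; case: ltnP => ?; [case: (qP i)|case: Pf].
have p'u : p^`().[u] != 0 by apply: sep_algebraic_deriv => //; apply/rootP.
have := dual_horner Rr Rpq Ruv; rewrite pu => /Rf e0.
have -> : v = - q'.[u] * p^`().[u]^-1.
  by apply: (mulfI p'u); rewrite mulrCA mulfV // mulr1; apply/eqP; rewrite -addr_eq0 addrC e0.
case: (Pf) => _ _ _ PN [PM PV]; apply: (PM); first by apply: PN; apply: subfield_horner.
apply: PV; apply: subfield_horner => // i; rewrite coef_deriv; apply: subfield_natmul => //.
by case: (FP _ (Fp i.+1)).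
Qed.

(** Here [p^D = 0], so the chain rule leaves [p'(u) v = 0]. It will be applied with a commutator as
    [R]. *)
Lemma sep_algebraic_constant R (F : E -> Prop) u v : dual_ring R -> functional R ->
  (forall y, F y -> R y 0) -> sep_algebraic_over F u -> R u v -> v = 0.
Proof.
move=> Rr Rf FR [p [_ Fp /rootP pu sp]] Ruv.
have p'u : p^`().[u] != 0 by apply: sep_algebraic_deriv => //; apply/rootP.
have Rp0 i : R p`_i (0 : {poly E})`_i by rewrite coef0; apply/FR.
have := dual_horner Rr Rp0 Ruv; rewrite pu horner0 add0r => /Rf /eqP.
by rewrite mulf_eq0 (negPf p'u) => /eqP.
Qed.

(* The quotients of elements of [T] form a subfield of dual numbers. *)
Lemma dual_closure_functional G T : dual_ring T -> functional T ->
  (forall y z, G y z -> T y z) -> functional (dual_closure G).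
Proof.
move=> [T1 TD TN TM] Tf GT.
pose R y z := exists f f' g g',
  [/\ T f f', T g g', g != 0, y = f / g & z = (f' * g - f * g') / (g * g)].
have Rf : dual_field R.
  split; [split|].
  - by exists 1, 0, 1, 0; rewrite oner_eq0 !mul0r !mulr0 subrr mul0r divr1.
  - move=> _ _ _ _ [f [f' [g [g' [Tf1 Tg g0 -> ->]]]]] [h [h' [k [k' [Th Tk k0 -> ->]]]]].
    exists (f * k + h * g), (f' * k + f * k' + (h' * g + h * g')), (g * k), (g' * k + g * k').
    by split; [apply: (TD); apply: (TM)|apply: (TM)|rewrite mulf_neq0|field; rewrite k0|field; rewrite k0].
  - move=> _ _ [f [f' [g [g' [Tf1 Tg g0 -> ->]]]]]; exists (- f), (- f'), g, g'.
    by split=> //; [apply: TN|rewrite mulNr|field].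
  - move=> _ _ _ _ [f [f' [g [g' [Tf1 Tg g0 -> ->]]]]] [h [h' [k [k' [Th Tk k0 -> ->]]]]].
    exists (f * h), (f' * h + f * h'), (g * k), (g' * k + g * k').
    by split; [apply: (TM)|apply: (TM)|rewrite mulf_neq0|field; rewrite k0|field; rewrite k0].
  move=> _ _ [f [f' [g [g' [Tf1 Tg g0 -> ->]]]]]; have [f0|f0] := eqVneq f 0.
    (* The inverse of 0 is 0, which needs a denominator other than [f]: it is written [0 / 1]. *)
    exists 0, 0, 1, 0; rewrite f0 !mul0r invr0 !mulr0 subrr mul0r oner_eq0; split=> //.
    by have := TD _ _ _ _ T1 (TN _ _ T1); rewrite !subrr.
  by exists g, g', f, f'; split=> //; field; rewrite ?f0.
have GR y z : G y z -> R y z.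
  by move=> /GT Tyz; exists y, z, 1, 0; rewrite oner_eq0 !divr1 mulr1 mulr0 subr0 mulr1 divr1.
move=> z /(dual_closure_le Rf GR)[f [f' [g [g' [Tf1 Tg g0 /esym/eqP]]]]].
rewrite mulf_eq0 invr_eq0 (negPf g0) orbF => /eqP f0 ->.
by rewrite f0 in Tf1 *; rewrite (Tf _ Tf1) !mul0r subrr mul0r.
Qed.

(** A transcendental element may be given any derivative. The pairs [(f(u), f^D(u) + f'(u) v)], with
    [f] over the domain of [R], form a dual ring; [f(u) = 0] forces [f = 0], and then [f^D = 0]
    because [R] is functional. Quotients are handled by [dual_closure_functional]. *)
Lemma transcendental_extend G u v : functional (dual_closure G) ->
  transcendental_over (dual_dom (dual_closure G)) u ->
  functional (dual_closure (fun y z => G y z \/ y = u /\ z = v)).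
Proof.
set R := dual_closure G => Rf utr; have [Rr _] := dual_closure_field G : dual_field R.
have [R1 RD RN RM] := Rr.
pose T y z := exists f f' : {poly E}, [/\ forall i, R f`_i f'`_i, y = f.[u] & z = f'.[u] + f^`().[u] * v].
apply: (@dual_closure_functional _ T).
- split.
  + exists 1, 0; rewrite derivC !hornerE; split=> // i; rewrite coef1 coef0.
    by case: eqP => _; [|apply: dual00].
  + move=> _ _ _ _ [f [f' [Rff' -> ->]]] [g [g' [Rgg' -> ->]]]; exists (f + g), (f' + g').
    by split=> [i||]; [rewrite !coefD; apply: RD|rewrite hornerD|rewrite derivD !hornerD; ring].
  + move=> _ _ [f [f' [Rff' -> ->]]]; exists (- f), (- f').
    by split=> [i||]; [rewrite !coefN; apply: RN|rewrite hornerN|rewrite derivN !hornerN; ring].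
  move=> _ _ _ _ [f [f' [Rff' -> ->]]] [g [g' [Rgg' -> ->]]].
  exists (f * g), (f' * g + f * g'); split=> [i||]; rewrite ?hornerM //; last by rewrite derivM !(hornerD, hornerM); ring.
  rewrite coefD !coefM -big_split /=; apply: dual_sum => // j _; exact: RM.
- move=> z [f [f' [Rff' fu0 ->]]].
  have f0 : f = 0 by apply: utr => [i|]; [exists f'`_i|apply/rootP].
  have -> : f' = 0.
    by apply/polyP => i; rewrite coef0; apply: Rf; have := Rff' i; rewrite f0 coef0.
  by rewrite f0 deriv0 !hornerE.
move=> y z [/dual_closure_gen Ryz|[-> ->]].
  exists y%:P, z%:P; rewrite derivC !hornerE; split=> // i; rewrite !coefC.
  by case: eqP => _ //; apply: dual00.
exists 'X, 0; rewrite derivX !hornerE; split=> // i; rewrite coefX coef0.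
by case: eqP => _; [|apply: dual00].
Qed.

Definition dual_commutator R1 R2 : E -> E -> Prop := fun y w =>
  exists a b c e, [/\ R1 y a, R2 y b, R1 b c, R2 a e & w = c - e].

(** Both composites of a product contain the mixed terms [a * b' + b * a'], which cancel in the
    difference; what remains is the Leibniz rule. *)
Lemma dual_commutator_field R1 R2 : dual_field R1 -> dual_field R2 ->
  dual_field (dual_commutator R1 R2).
Proof.
move=> [[R11 R1D R1N R1M] R1V] [[R21 R2D R2N R2M] R2V].
have R100 : R1 0 0 by apply: dual00; split.
have R200 : R2 0 0 by apply: dual00; split.
split; [split|].
- by exists 0, 0, 0, 0; split=> //; rewrite subrr.
- move=> y w y' w' [a [b [c [e [? ? ? ? ->]]]]] [a' [b' [c' [e' [? ? ? ? ->]]]]].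
  by exists (a + a'), (b + b'), (c + c'), (e + e'); split; auto; ring.
- move=> y w [a [b [c [e [? ? ? ? ->]]]]].
  by exists (- a), (- b), (- c), (- e); split; auto; ring.
- move=> y w y' w' [a [b [c [e [? ? ? ? ->]]]]] [a' [b' [c' [e' [? ? ? ? ->]]]]].
  exists (a * y' + y * a'), (b * y' + y * b'),
    (c * y' + b * a' + (a * b' + y * c')), (e * y' + a * b' + (b * a' + y * e')).
  by split; auto; ring.
move=> y w [a [b [c [e [ya yb bc ae ->]]]]].
have iV1 := R1V _ _ ya; have iV2 := R2V _ _ yb.
exists (- a * y^-1 * y^-1), (- b * y^-1 * y^-1); do 2 eexists; split=> //.
- exact: R1M (R1M _ _ _ _ (R1N _ _ bc) iV1) iV1.
- exact: R2M (R2M _ _ _ _ (R2N _ _ ae) iV2) iV2.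
by ring.
Qed.

Lemma dual_commutator_functional R1 R2 : functional R1 -> functional R2 ->
  functional (dual_commutator R1 R2).
Proof.
move=> R1f R2f w [a [b [c [e [/R1f-> /R2f-> /R1f-> /R2f-> ->]]]]].
by rewrite subrr.
Qed.

End DualNumbers.

(** * The order on the generators *)

Section Position.
Local Open Scope nat_scope.

(** The number with base [B] digits [l], most significant first; for lists of one length with
    entries below [B] it turns the lexicographic order into that of the integers. *)
Fixpoint radix (B : nat) (l : seq nat) : nat :=
  if l is x :: l' then x * B ^ size l' + radix B l' else 0.

Lemma radix_lt B l : all (fun x => x < B) l -> radix B l < B ^ size l.
Proof.
elim: l => //= x l IHl /andP[xB /IHl lB].
apply: (@leq_trans (x.+1 * B ^ size l)); first by rewrite mulSn addnC ltn_add2r.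
by rewrite expnS leq_mul2r xB orbT.
Qed.

Lemma lexle_radix B l l' : size l = size l' -> all (fun x => x < B) l ->
  all (fun x => x < B) l' -> lexle l l' = (radix B l <= radix B l').
Proof.
elim: l l' => [|x l IHl] [|y l'] //= [sll'] /andP[xB lB] /andP[yB l'B].
rewrite IHl // sll'; have := radix_lt lB; have := radix_lt l'B; rewrite sll'.
set b := B ^ _ => rl' rl; case: (ltngtP x y) => [xy|yx|->] /=; last by rewrite leq_add2l.
  have : x.+1 * b <= y * b by rewrite leq_mul2r xy orbT.
  by rewrite mulSn; lia.
have : y.+1 * b <= x * b by rewrite leq_mul2r yx orbT.
by rewrite mulSn; lia.
Qed.

Lemma lexle_antisym s t : size s = size t -> lexle s t -> lexle t s -> s = t.
Proof.
elim: s t => [|x s IHs] [|y t] //= [st]; case: (ltngtP x y) => //= -> ? ?.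
by rewrite (IHs t).
Qed.

Lemma lexle_add (I : Type) (s : seq I) (x y c : I -> nat) :
  lexle [seq x i + c i | i <- s] [seq y i + c i | i <- s]
  = lexle [seq x i | i <- s] [seq y i | i <- s].
Proof. by elim: s => //= i s ->; rewrite ltn_add2r eqn_add2r. Qed.

Variables m n : nat.
Implicit Types (xi eta : mindex m) (k g : 'I_n) (i : 'I_m) (p q : mindex m * 'I_n).

Lemma msize_add_eps xi i : msize_idx (add_eps xi i) = (msize_idx xi).+1.
Proof.
rewrite /msize_idx; under eq_bigr do rewrite ffunE.
rewrite big_split /= -addn1; congr addn.
by rewrite (bigD1 i) //= eqxx big1 // => j /negPf->.
Qed.

Lemma leq_msize xi i : xi i <= msize_idx xi.
Proof. by rewrite /msize_idx (bigD1 i) //= leq_addr. Qed.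

Lemma tle_add_eps xi eta k g i :
  tle (add_eps xi i) k (add_eps eta i) g = tle xi k eta g.
Proof.
rewrite /tle /tri_key /= !msize_add_eps ltnS eqSS.
under eq_map do rewrite ffunE; under [in X in lexle _ X]eq_map do rewrite ffunE.
by rewrite lexle_add.
Qed.

(** At size [u] the key has [m] further entries, each at most [u + n], so [(u + n).+1 ^ m] codes
    suffice. Indices of size [s] get positions from [level_start s] up to, but excluding,
    [level_start s.+1]. *)
Definition level_start (s : nat) : nat := \sum_(u < s) (u + n).+1 ^ m.

Lemma level_start_mono s t : s <= t -> level_start s <= level_start t.
Proof.
move=> /subnK <-; elim: (t - s) => // u IHu.
by rewrite addSn /level_start big_ord_recr /= (leq_trans IHu) // leq_addr.
Qed.

(** An order embedding of the indices into the integers, which makes the construction an induction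
    on [nat]. It leaves gaps, so some steps of that induction have nothing to do. *)
Definition pos p : nat :=
  level_start (msize_idx p.1) + radix (msize_idx p.1 + n).+1 (behead (tri_key p.1 p.2)).

Hypothesis m_gt0 : 0 < m.

Lemma size_tri_key xi k : size (behead (tri_key xi k)) = m.
Proof. by rewrite /= size_map size_takel ?size_enum_ord ?leq_pred // prednK. Qed.

Lemma tri_key_bound xi k :
  all (fun x => x < (msize_idx xi + n).+1) (behead (tri_key xi k)).
Proof.
apply/andP; split; first by rewrite ltnS (leq_trans (ltnW (ltn_ord k))) // leq_addl.
by apply/allP => _ /mapP[i _ ->]; rewrite ltnS (leq_trans (leq_msize xi i)) // leq_addr.
Qed.

Lemma pos_lt_next p : pos p < level_start (msize_idx p.1).+1.
Proof.
rewrite /pos /level_start big_ord_recr ltn_add2l.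
by have := radix_lt (tri_key_bound p.1 p.2); rewrite size_tri_key.
Qed.

Lemma pos_lt_level p s : (pos p < level_start s) = (msize_idx p.1 < s).
Proof.
case: (ltnP (msize_idx p.1) s) => [/level_start_mono ps|/level_start_mono sp].
  by rewrite (leq_trans (pos_lt_next p)).
by apply/negbTE; rewrite -leqNgt (leq_trans sp) // leq_addr.
Qed.

Lemma pos_lt_msize p q : msize_idx p.1 < msize_idx q.1 -> pos p < pos q.
Proof. by rewrite -pos_lt_level => /leq_trans; apply; apply: leq_addr. Qed.

Lemma tle_pos p q : tle p.1 p.2 q.1 q.2 = (pos p <= pos q).
Proof.
have -> : tle p.1 p.2 q.1 q.2 = (msize_idx p.1 < msize_idx q.1) ||
    (msize_idx p.1 == msize_idx q.1) &&
    lexle (behead (tri_key p.1 p.2)) (behead (tri_key q.1 q.2)) by [].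
case: (ltngtP (msize_idx p.1) (msize_idx q.1)) => [pq|qp|pq]; rewrite ?orTb ?orFb ?andFb ?andTb.
- by rewrite ltnW // pos_lt_msize.
- by apply/esym/negbTE; rewrite -ltnNge pos_lt_msize.
rewrite /pos pq leq_add2l.
apply: lexle_radix; rewrite ?size_tri_key ?tri_key_bound //.
by rewrite -pq tri_key_bound.
Qed.

(** The key omits the last entry of the multi-index, but that entry is recovered from the total
    size. *)
Lemma pos_inj : injective pos.
Proof.
move=> [xi k] [eta g] pq.
have : tri_key xi k = tri_key eta g.
  apply: lexle_antisym; first by rewrite /= !size_map.
    by rewrite -[lexle _ _]/(tle (xi, k).1 (xi, k).2 (eta, g).1 (eta, g).2) tle_pos pq.
  by rewrite -[lexle _ _]/(tle (eta, g).1 (eta, g).2 (xi, k).1 (xi, k).2) tle_pos pq.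
case=> sxi /val_inj -> xieta; congr pair; apply/ffunP.
move: xi eta sxi xieta {pq}; case: m m_gt0 => // m' _ xi eta.
have szw : size (map (widen_ord (leqnSn m')) (enum 'I_m')) = m'.
  by rewrite size_map size_enum_ord.
rewrite /msize_idx !big_ord_recr /= enum_ordSr -cats1 takel_cat ?szw //.
rewrite take_oversize ?szw // => sxi /eq_in_map xieta.
have xw (i : 'I_m') : xi (widen_ord (leqnSn m') i) = eta (widen_ord (leqnSn m') i).
  by apply: xieta; apply: map_f; rewrite mem_enum.
move=> i; case: (unliftP ord_max i) => [j ->|->]; last first.
  move: sxi; rewrite (eq_bigr (fun i : 'I_m' => eta (widen_ord (leqnSn m') i))) => [|j _].
    exact: addnI.
  exact: xw.
have -> : lift ord_max j = widen_ord (leqnSn m') j by apply/val_inj; rewrite /= /bump leqNgt ltn_ord.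
exact: xw.
Qed.

Lemma tlt_pos p q : tlt p.1 p.2 q.1 q.2 = (pos p < pos q).
Proof.
rewrite /tlt tle_pos ltn_neqAle andbC; congr (~~ _ && _).
by rewrite (inj_eq pos_inj); case: p q => ? ? [].
Qed.

Definition shift p i : mindex m * 'I_n := (add_eps p.1 i, p.2).

Lemma pos_shift p q i : (pos (shift p i) < pos (shift q i)) = (pos p < pos q).
Proof. by rewrite !ltnNge -!tle_pos tle_add_eps. Qed.

Lemma pos_ltn_shift p i : pos p < pos (shift p i).
Proof. by apply: pos_lt_msize; rewrite msize_add_eps. Qed.

Lemma shift_comm p i j : shift (shift p i) j = shift (shift p j) i.
Proof. by congr pair; apply/ffunP => u; rewrite !ffunE addnAC. Qed.

Lemma shift_inj i : injective (shift^~ i).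
Proof.
move=> [xi k] [eta g] [/ffunP e ->]; congr pair; apply/ffunP => j.
by have := e j; rewrite !ffunE => /addIn.
Qed.

End Position.

(** * The differential condition as a derivation *)

Definition deriv_gen (K E : fieldType) (m n : nat) (d : 'I_m -> K -> K) (iK : K -> E)
    (b : mindex m * 'I_n -> E) (S : mindex m * 'I_n -> Prop) (i : 'I_m) : E -> E -> Prop :=
  fun y z => (exists c, y = iK c /\ z = iK (d i c)) \/
             (exists p, [/\ S p, y = b p & z = b (shift p i)]).

Lemma map_mpoly_deriv (K : fieldType) (N : nat) (D : {additive K -> K}) (f g : {mpoly K[N]}) :
  (forall x y, D (x * y) = D x * y + x * D y) ->
  map_mpoly D (f * g) = map_mpoly D f * g + f * map_mpoly D g.
Proof.
move=> DM; apply/mpolyP => mo; rewrite mcoeffD mcoeff_map_mpoly !mcoeffM raddf_sum -big_split.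
by apply: eq_bigr => k _; rewrite /= DM !mcoeff_map_mpoly.
Qed.

Section VarsIn.
Variables (K : fieldType) (N : nat) (P : 'I_N -> bool).
Implicit Types f g : {mpoly K[N]}.

Lemma vars_inC c : vars_in (c%:MP_[N] : {mpoly K[N]}) P.
Proof.
move=> mo; rewrite msuppC; case: eqP => _; rewrite ?inE // => /eqP-> j.
by rewrite mnm0E.
Qed.

Lemma vars_inX j : P j -> vars_in ('X_j : {mpoly K[N]}) P.
Proof.
move=> Pj mo; rewrite msuppX inE => /eqP-> k.
by rewrite mnm1E; case: eqP => [<-|].
Qed.

Lemma vars_inD f g : vars_in f P -> vars_in g P -> vars_in (f + g) P.
Proof. by move=> Pf Pg mo /msuppD_le; rewrite mem_cat => /orP[/Pf|/Pg]. Qed.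

Lemma vars_inN f : vars_in f P -> vars_in (- f) P.
Proof. by move=> Pf mo; rewrite (perm_mem (msuppN f)) => /Pf. Qed.

Lemma vars_inM f g : vars_in f P -> vars_in g P -> vars_in (f * g) P.
Proof.
move=> Pf Pg mo /msuppM_le /allpairsP[[m1 m2] /= [/Pf Pm1 /Pg Pm2 ->]] j.
by rewrite mnmDE addn_gt0 => /orP[/Pm1|/Pm2].
Qed.

End VarsIn.

Section BaseFunctional.
Variables (K L : fieldType) (m n r : nat) (d : 'I_m -> K -> K).
Variables (iota : {rmorphism K -> L}) (a : mindex m -> 'I_n -> L).
Hypotheses (m_gt0 : (0 < m)%N) (dd : commuting_derivations d) (r_gt0 : (0 < r)%N)
  (n_gt0 : (0 < n)%N) (dc : differential_condition r d iota a).

Lemma var_of_index (p : mindex m * 'I_n) : (msize_idx p.1 <= 2 * r)%N ->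
  exists j : 'I_(nvars m n r), var_xi j = p.1 /\ var_h j = p.2.
Proof.
move=> pr; exists (enum_rank ([ffun i => inord (p.1 i)], p.2) : 'I_(nvars m n r)).
rewrite /var_xi /var_h /var_idx enum_rankK; split=> //.
apply/ffunP => i; rewrite !ffunE inordK // ltnS.
exact: leq_trans (leq_msize _ _) pr.
Qed.

(** The differential condition is relative to an upper bound [(sigma, k)]; the largest index of size
    below [2 * r] is a bound that covers all of them at once. *)
Lemma exists_max_index s : (0 < s)%N ->
  exists q : mindex m * 'I_n, (msize_idx q.1 < s)%N /\
    forall p : mindex m * 'I_n, (msize_idx p.1 < s)%N -> (pos p <= pos q)%N.
Proof.
move=> s0; pose Q k := `[< exists p : mindex m * 'I_n, (msize_idx p.1 < s)%N /\ pos p = k >].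
have exQ : exists k, Q k.
  exists (pos ([ffun => 0%N] : mindex m, Ordinal n_gt0)); apply/asboolP.
  exists ([ffun => 0%N], Ordinal n_gt0); split=> //.
  by rewrite /msize_idx big1 // => i _; rewrite ffunE.
have bQ k : Q k -> (k <= level_start m n s)%N.
  by move=> /asboolP[p [ps <-]]; rewrite ltnW // pos_lt_level.
have [k /asboolP[q [qs <-]] kmax] := ex_maxnP exQ bQ.
by exists q; split=> // p ps; apply: kmax; apply/asboolP; exists p.
Qed.

Lemma derivation_zmod i : zmod_morphism (d i).
Proof.
move=> x y; have [/(_ i)[dD _] _] := dd.
by apply/eqP; rewrite eq_sym subr_eq -dD subrK.
Qed.

(** The pairs formed by a value [f(a)] and the formal derivative of [f] evaluated at [a] make up a
    dual ring [T]. The differential condition at the maximal index [q] says precisely that [T] is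
    functional, and passing to quotients preserves this. *)
Lemma base_functional i :
  functional (dual_closure (deriv_gen d iota (fun p => a p.1 p.2)
    (fun p => (msize_idx p.1 < 2 * r)%N) i)).
Proof.
have r2 : (0 < 2 * r)%N by rewrite muln_gt0.
have [q [qr qmax]] := exists_max_index r2.
pose D : {additive K -> K} := HB.pack (d i) (GRing.isZmodMorphism.Build K K (d i) (derivation_zmod i)).
have DM x y : D (x * y) = D x * y + x * D y by have [/(_ i)[_ dM] _] := dd; apply: dM.
have D1 : D 1 = 0 by have /eqP := DM 1 1; rewrite !mulr1 mul1r -subr_eq0 opprD addNKr oppr_eq0 => /eqP.
pose P (j : 'I_(nvars m n r)) := tle (var_xi j) (var_h j) q.1 q.2.
pose x := apoint a : 'I_(nvars m n r) -> L.
pose ev (f : {mpoly K[nvars m n r]}) := (map_mpoly iota f).@[x].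
pose dv f := \sum_(j < nvars m n r | P j) ev (mderiv j f) * a (add_eps (var_xi j) i) (var_h j)
  + ev (map_mpoly D f).
pose T y z := exists f, [/\ vars_in f P, y = ev f & z = dv f].
have evD f g : ev (f + g) = ev f + ev g by rewrite /ev !rmorphD.
have evM f g : ev (f * g) = ev f * ev g by rewrite /ev !rmorphM.
have evN f : ev (- f) = - ev f by rewrite /ev !rmorphN.
have evC c : ev c%:MP = iota c by rewrite /ev map_mpolyC mevalC.
have ev0 : ev 0 = 0 by rewrite /ev !rmorph0.
have dvC c : dv c%:MP = iota (d i c).
  rewrite /dv big1 => [|j _]; last by rewrite mderivC ev0 mul0r.
  by rewrite add0r map_mpolyC evC.
apply: (@dual_closure_functional _ _ T).
- split.
  + exists 1; split; [exact: vars_inC|by rewrite /ev !rmorph1|].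
    by rewrite -mpolyC1 dvC -[d i 1]/(D 1) D1 rmorph0.
  + move=> _ _ _ _ [f [Pf -> ->]] [g [Pg -> ->]]; exists (f + g).
    split; [exact: vars_inD|by rewrite evD|].
    rewrite /dv [map_mpoly D (f + g)]raddfD evD addrACA -big_split; congr (_ + _).
    by apply: eq_bigr => j _; rewrite /= mderivD evD mulrDl.
  + move=> _ _ [f [Pf -> ->]]; exists (- f).
    split; [exact: vars_inN|by rewrite evN|].
    rewrite /dv [map_mpoly D (- f)]raddfN evN opprD -sumrN; congr (_ + _).
    by apply: eq_bigr => j _; rewrite /= mderivN evN mulNr.
  move=> _ _ _ _ [f [Pf -> ->]] [g [Pg -> ->]]; exists (f * g).
  split; [exact: vars_inM|by rewrite evM|].
  rewrite /dv map_mpoly_deriv // evD !evM mulrDl mulrDr addrACA; congr (_ + _).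
  rewrite mulr_suml mulr_sumr -big_split; apply: eq_bigr => j _.
  by rewrite /= mderivM evD !evM mulrDl mulrA; congr (_ + _); rewrite mulrAC.
- move=> z [f [Pf /esym f0 ->]]; apply: (@dc i q.1 q.2 _ f Pf f0).
  by rewrite addn1.
move=> y z [[c [-> ->]]|[p [pr -> ->]]].
  by exists c%:MP; split; [exact: vars_inC|rewrite evC|rewrite dvC].
have [j [jp jh]] := var_of_index (ltnW pr).
have Pj : P j by rewrite /P jp jh (tle_pos m_gt0) qmax.
exists 'X_j; split; [exact: vars_inX|by rewrite /ev map_mpolyX mevalXU /x /apoint jp jh|].
rewrite /dv (bigD1 j) //= big1 => [|k /andP[_ kj]].
  have -> : map_mpoly D 'X_j = 0.
    apply/mpolyP => mo; rewrite mcoeff_map_mpoly mcoeff0 mcoeffX.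
    by case: eqP => _; rewrite ?raddf0.
  rewrite ev0 !addr0 mderivX mnm1E eqxx.
  have -> : (U_(j) - U_(j) = 0)%MM by apply/mnmP => k; rewrite mnmBE mnm0E subnn.
  by rewrite mpolyX0 scale1r /ev !rmorph1 mul1r /= jp jh.
by rewrite mderivX mnm1E eq_sym (negPf kj) scale0r ev0 mul0r.
Qed.

End BaseFunctional.

(** * Generated subfields and multi-indices *)

Section GenField.
Variables (K E : fieldType) (iK : K -> E).
Implicit Types (S : E -> Prop).

Lemma gen_field_closed S : subfield_closed (gen_field iK S).
Proof.
split; [| | | |split].
- by move=> P [].
- by move=> P [].
- by move=> y z Sy Sz P Pf Pc PS; case: (Pf) => _ _ PD _ _; apply: PD; [apply: Sy|apply: Sz].
- by move=> y Sy P Pf Pc PS; case: (Pf) => _ _ _ PN _; apply: PN; apply: Sy.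
- by move=> y z Sy Sz P Pf Pc PS; case: (Pf) => _ _ _ _ [PM _]; apply: PM; [apply: Sy|apply: Sz].
by move=> y Sy P Pf Pc PS; case: (Pf) => _ _ _ _ [_ PV]; apply: PV; apply: Sy.
Qed.

Lemma gen_field_const S c : gen_field iK S (iK c).
Proof. by move=> P _ Pc _. Qed.

Lemma gen_field_gen S y : S y -> gen_field iK S y.
Proof. by move=> Sy P _ _; apply. Qed.

Lemma gen_field_le S (P : E -> Prop) : subfield_closed P -> (forall c, P (iK c)) ->
  (forall y, S y -> P y) -> forall y, gen_field iK S y -> P y.
Proof. by move=> Pf Pc PS y; apply. Qed.

End GenField.

Lemma subfield_preim (L E : fieldType) (j : {rmorphism L -> E}) (P : E -> Prop) :
  subfield_closed P -> subfield_closed (fun y => P (j y)).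
Proof.
case=> P0 P1 PD PN [PM PV]; split; [| | | |split] => [||y z|y|y z|y].
- by rewrite rmorph0.
- by rewrite rmorph1.
- by rewrite rmorphD; apply: PD.
- by rewrite rmorphN; apply: PN.
- by rewrite rmorphM; apply: PM.
by rewrite fmorphV; apply: PV.
Qed.

Lemma dual_dom_closed (E : fieldType) (R : E -> E -> Prop) :
  dual_field R -> subfield_closed (dual_dom R).
Proof.
move=> [Rr RV]; have [R1 RD RN RM] := Rr; split; [| | | |split].
- by exists 0; apply: dual00.
- by exists 0.
- by move=> y z [y' ?] [z' ?]; exists (y' + z'); apply: RD.
- by move=> y [y' ?]; exists (- y'); apply: RN.
- by move=> y z [y' ?] [z' ?]; exists (y' * z + y * z'); apply: RM.
by move=> y [y' ?]; eexists; apply: RV; eassumption.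
Qed.

Lemma dual_constants_closed (E : fieldType) (R : E -> E -> Prop) :
  dual_field R -> subfield_closed (fun y => R y 0).
Proof.
move=> [Rr RV]; have [R1 RD RN RM] := Rr; split; [| | | |split].
- exact: dual00.
- exact: R1.
- by move=> y z Ry Rz; rewrite -[0]addr0; apply: RD.
- by move=> y Ry; rewrite -oppr0; apply: RN.
- by move=> y z Ry Rz; have := RM _ _ _ _ Ry Rz; rewrite mul0r mulr0 addr0.
by move=> y Ry; have := RV _ _ Ry; rewrite oppr0 !mul0r.
Qed.

Section Multiindices.
Variables m n : nat.
Implicit Types (rho sigma : mindex m) (p s : mindex m * 'I_n) (i : 'I_m).

Definition sub_eps sigma i : mindex m := [ffun j => (sigma j - (j == i))%N].

Lemma sub_epsK sigma i : (0 < sigma i)%N -> add_eps (sub_eps sigma i) i = sigma.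
Proof.
move=> si; apply/ffunP => j; rewrite !ffunE.
by case: eqP => [->|_]; rewrite ?subn0 ?addn0 // subn1 addn1 prednK.
Qed.

Lemma mle_refl sigma : mle sigma sigma.
Proof. exact/forallP. Qed.

Lemma mle_trans rho sigma tau : mle rho sigma -> mle sigma tau -> mle rho tau.
Proof. by move=> /forallP rs /forallP st; apply/forallP => i; apply: leq_trans (st i). Qed.

Lemma mle_add_eps sigma i : mle sigma (add_eps sigma i).
Proof. by apply/forallP => j; rewrite ffunE leq_addr. Qed.

Lemma mle_msize rho sigma : mle rho sigma -> (msize_idx rho <= msize_idx sigma)%N.
Proof. by move=> /forallP rs; apply: leq_sum. Qed.

Lemma mle_msize_eq rho sigma :
  mle rho sigma -> (msize_idx sigma <= msize_idx rho)%N -> rho = sigma.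
Proof.
move=> /forallP rs sr; apply/ffunP => i; apply/eqP; rewrite eqn_leq rs /= leqNgt.
apply/negP => rsi; move: sr; rewrite leqNgt => /negP; apply.
rewrite /msize_idx (bigD1 i) //= [X in (_ < X)%N](bigD1 i) //= -addSn.
by apply: leq_add => //; apply: leq_sum.
Qed.

Lemma mle_pred rho sigma : mle rho sigma -> (msize_idx rho < msize_idx sigma)%N ->
  exists i sigma', add_eps sigma' i = sigma /\ mle rho sigma'.
Proof.
move=> rs srs; have /forallP rsi := rs.
case: (boolP [forall i, sigma i <= rho i]%N) => [/mle_msize|].
  by rewrite leqNgt srs.
rewrite negb_forall => /existsP[i]; rewrite -ltnNge => ri; exists i, (sub_eps sigma i).
split; first by apply/sub_epsK/(leq_trans _ ri).
by apply/forallP => j; rewrite ffunE; case: eqP => [->|_]; rewrite ?subn0 //; lia.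
Qed.

Definition mjoin rho sigma : mindex m := [ffun i => maxn (rho i) (sigma i)].

Lemma mle_joinl rho sigma : mle rho (mjoin rho sigma).
Proof. by apply/forallP => i; rewrite ffunE leq_maxl. Qed.

Lemma mle_joinr rho sigma : mle sigma (mjoin rho sigma).
Proof. by apply/forallP => i; rewrite ffunE leq_maxr. Qed.

Lemma mjoin_le rho sigma tau : mle rho tau -> mle sigma tau -> mle (mjoin rho sigma) tau.
Proof.
by move=> /forallP rt /forallP st; apply/forallP => i; rewrite ffunE geq_max rt st.
Qed.

Lemma msize_join rho sigma :
  (msize_idx (mjoin rho sigma) <= msize_idx rho + msize_idx sigma)%N.
Proof.
rewrite /msize_idx -big_split; apply: leq_sum => i _; rewrite ffunE /=.
by rewrite geq_max leq_addr leq_addl.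
Qed.

(** The index [p] is [s] lowered at [i']. There it agrees with [s'], and at all other coordinates
    with [s], so [rho] remains below it. *)
Lemma shift_diamond rho s s' i i' : i != i' -> shift s i = shift s' i' ->
  mle rho s.1 -> mle rho s'.1 ->
  exists p, [/\ s = shift p i', s' = shift p i & mle rho p.1].
Proof.
move=> ii' ss' /forallP rs /forallP rs'; have [/ffunP se _] := ss'.
have si' : s.1 i' = (s'.1 i').+1.
  by have := se i'; rewrite !ffunE eqxx eq_sym (negPf ii') addn0 addn1.
have sE : s = shift (sub_eps s.1 i', s.2) i'.
  by rewrite /shift sub_epsK ?si' //; case: (s).
exists (sub_eps s.1 i', s.2); split=> //.
  by apply: (@shift_inj _ _ i'); rewrite -ss' {1}sE shift_comm.
by apply/forallP => j; rewrite ffunE; case: eqP => [->|_]; rewrite ?subn0 ?si' ?subn1.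
Qed.

End Multiindices.

(** * Prolongation of the generators *)

Section Prolongation.
Variables (K L : fieldType) (m n r : nat) (d : 'I_m -> K -> K).
Variables (iota : {rmorphism K -> L}) (a : mindex m -> 'I_n -> L).
Hypotheses (m_gt0 : (0 < m)%N) (dd : commuting_derivations d) (r_gt0 : (0 < r)%N)
  (n_gt0 : (0 < n)%N) (dc : differential_condition r d iota a).
Hypothesis min_lead : forall (sigma : mindex m) (k : 'I_n), (msize_idx sigma <= 2 * r)%N ->
  min_sep_leader r iota a sigma k -> (msize_idx sigma <= r)%N.

Variables (E : fieldType) (j : {rmorphism L -> E}) (P : nat -> E -> Prop) (x : nat -> E).
Hypotheses (P_closed : forall t, subfield_closed (P t))
  (P_mono : forall s t y, (s <= t)%N -> P s y -> P t y)
  (P0 : forall y, P 0%N (j y)) (Px : forall t, P t.+1 (x t))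
  (x_trans : forall t, transcendental_over (P t) (x t)).

Local Notation index := (mindex m * 'I_n)%type.
Local Notation low := (low_field r iota a).
Implicit Types (p tau : index) (i : 'I_m) (t : nat) (b : index -> E).

Let iK : K -> E := j \o iota.
Let A p : L := a p.1 p.2.

(** * Fields and derivations generated before a given position *)

Definition before b t : E -> Prop := gen_field iK (fun y => exists p, (pos p < t)%N /\ y = b p).

(** The bound is put on the shifted index, so that both a generator and its derivative lie in
    [before b t]. *)
Definition stage_gen b t i : E -> E -> Prop :=
  deriv_gen d iK b (fun p => (pos (shift p i) < t)%N) i.

Local Notation stage b t i := (dual_closure (stage_gen b t i)).

(** Being above a small separable leader is an upward closed property that refers to [a] only, so it
    is not affected by the choice of the new generators [b]. *)
Definition lead p : Prop := exists rho : mindex m,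
  [/\ mle rho p.1, (msize_idx rho <= r)%N & sep_leader r iota a rho p.2].

Definition agree b b' t : Prop := forall p, (pos p < t)%N -> b p = b' p.

Definition update b tau (v : E) : index -> E := fun p => if p == tau then v else b p.

Lemma agree_update b tau v : agree b (update b tau v) (pos tau).
Proof. by move=> p; rewrite /update; case: eqP => [->|]; rewrite ?ltnn. Qed.

Lemma agree_sym b b' t : agree b b' t -> agree b' b t.
Proof. by move=> bb' p pt; rewrite bb'. Qed.

Lemma agreeW b b' s t : (s <= t)%N -> agree b b' t -> agree b b' s.
Proof. by move=> st bb' p ps; apply/bb'/(leq_trans ps). Qed.

Lemma before_closed b t : subfield_closed (before b t).
Proof. exact: gen_field_closed. Qed.

Lemma before_gen b t p : (pos p < t)%N -> before b t (b p).
Proof. by move=> pt; apply: gen_field_gen; exists p. Qed.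

Lemma before_const b t c : before b t (iK c).
Proof. exact: gen_field_const. Qed.

Lemma before_le b b' t t' : (t <= t')%N -> agree b b' t ->
  forall y, before b t y -> before b' t' y.
Proof.
move=> tt' bb'; apply: gen_field_le => [|c|_ [p [pt ->]]]; first exact: before_closed.
  exact: before_const.
by rewrite bb' //; apply: before_gen; apply: leq_trans tt'.
Qed.

Lemma before_mono b t t' y : (t <= t')%N -> before b t y -> before b t' y.
Proof. by move=> tt'; apply: before_le. Qed.

Lemma stage_field b t i : dual_field (stage b t i).
Proof. exact: dual_closure_field. Qed.

Lemma stage_gen_le b b' t t' i : (t <= t')%N -> agree b b' t ->
  forall y z, stage_gen b t i y z -> stage_gen b' t' i y z.
Proof.
move=> tt' bb' y z [[c [-> ->]]|[p [pt -> ->]]]; first by left; exists c.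
right; exists p; split; first exact: leq_trans pt tt'.
  by apply: bb'; apply: ltn_trans pt; apply: pos_ltn_shift.
exact: bb'.
Qed.

Lemma stage_le b b' t t' i : (t <= t')%N -> agree b b' t ->
  forall y z, stage b t i y z -> stage b' t' i y z.
Proof. by move=> tt' bb'; apply: dual_closure_mono; apply: stage_gen_le. Qed.

Lemma stage_const b t i c : stage b t i (iK c) (iK (d i c)).
Proof. by apply: dual_closure_gen; left; exists c. Qed.

Lemma stage_shift b t i p : (pos (shift p i) < t)%N -> stage b t i (b p) (b (shift p i)).
Proof. by move=> pt; apply: dual_closure_gen; right; exists p. Qed.

Lemma stage_range b t i y z : stage b t i y z -> before b t z.
Proof.
move=> /(@dual_closure_range _ _ (before b t)) []//; first exact: before_closed.
move=> y' z' [[c [-> ->]]|[p [pt -> ->]]]; first by split; apply: before_const.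
by split; apply: before_gen => //; apply: ltn_trans pt; apply: pos_ltn_shift.
Qed.

(** Shifting by [i] preserves the order, so the generators whose shift precedes [shift s i] are
    those preceding [s]. Together with [stage_total] this determines the domain of the stage
    exactly. *)
Lemma stage_dom b (s : index) i y z : stage b (pos (shift s i)) i y z -> before b (pos s) y.
Proof.
apply: dual_closure_domP => [|{}y {}z [[c [-> _]]|[p [pt -> _]]]]; first exact: before_closed.
  exact: before_const.
by apply: before_gen; rewrite -(pos_shift m_gt0 _ _ i).
Qed.

Lemma stage_total b (s : index) i y : before b (pos s) y -> exists z, stage b (pos (shift s i)) i y z.
Proof.
apply: (@gen_field_le _ _ _ _ (dual_dom (stage b (pos (shift s i)) i))) => [|c|_ [p [pt ->]]].
- exact: dual_dom_closed (stage_field _ _ _).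
- by eexists; apply: stage_const.
by exists (b (shift p i)); apply: stage_shift; rewrite pos_shift.
Qed.

Lemma stage_gen_next b t i y z : stage_gen b t.+1 i y z ->
  stage_gen b t i y z \/ exists s : index, [/\ pos (shift s i) = t, y = b s & z = b (shift s i)].
Proof.
case=> [[c [-> ->]]|[p [pt -> ->]]]; first by left; left; exists c.
move: pt; rewrite ltnS leq_eqVlt => /orP[/eqP pt|pt]; first by right; exists p.
by left; right; exists p.
Qed.

(** The case is not decided by [lead] alone: at size [2 * r] a lead index could a priori get a
    transcendental value. Once the stages are functional, [lead_before] excludes this. *)
Definition dichotomy b p : Prop := (lead p /\ before b (pos p) (b p)) \/
  transcendental_over (before b (pos p)) (b p).

(** The low values are fixed from the start, whatever [t] is. The last clause keeps [x t]
    transcendental over all values at positions below [t]. *)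
Definition extends_low b t : Prop :=
  [/\ forall p, (msize_idx p.1 < 2 * r)%N -> b p = j (A p),
      forall p, (pos p < t)%N -> (2 * r <= msize_idx p.1)%N -> dichotomy b p &
      forall p, (pos p < t)%N -> P (pos p).+1 (b p)].

Lemma dichotomy_agree b b' p : agree b b' (pos p).+1 -> dichotomy b p -> dichotomy b' p.
Proof.
move=> bb' []; rewrite (bb' p) //.
  by move=> [lp bp]; left; split=> //; move: bp; apply: before_le => //; apply: agreeW bb'.
move=> tr; right; apply: transcendental_overW tr; apply: before_le => //.
by apply: agree_sym; apply: agreeW bb'.
Qed.

Lemma before_stage b t y : (forall p, (pos p < t)%N -> P (pos p).+1 (b p)) ->
  before b t y -> P t y.
Proof.
move=> bP; move: y; apply: gen_field_le => // [c|_ [p [pt ->]]]; first exact: P_mono (P0 _).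
exact: P_mono (bP _ pt).
Qed.

Lemma extends_low_skip b t : (forall p, pos p <> t) -> extends_low b t -> extends_low b t.+1.
Proof.
move=> nt [blow bdich bP].
have lt p : (pos p < t.+1)%N -> (pos p < t)%N by rewrite ltnS leq_eqVlt => /orP[/eqP/nt|].
by split=> // p /lt pt; [apply: bdich|apply: bP].
Qed.

Lemma extends_low_update b tau v : extends_low b (pos tau) -> (2 * r <= msize_idx tau.1)%N ->
  (lead tau /\ before b (pos tau) v) \/ v = x (pos tau) ->
  extends_low (update b tau v) (pos tau).+1.
Proof.
move=> [blow bdich bP] r2 vtau; have upd := @agree_update b tau v.
have updtau : update b tau v tau = v by rewrite /update eqxx.
have vP : P (pos tau).+1 v.
  by case: vtau => [[_ /(before_stage bP)]|->]; [apply: P_mono|].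
have dtau : dichotomy (update b tau v) tau.
  rewrite /dichotomy updtau; case: vtau => [[ltau bv]|->]; [left|right].
    by split=> //; apply: before_le bv.
  apply: (@transcendental_overW _ (P (pos tau))) => // y.
  have dpu : agree (update b tau (x (pos tau))) b (pos tau) by apply: agree_sym; apply: agree_update.
  by move/(before_le (leqnn _) dpu); apply: before_stage.
split.
- by move=> p pr; rewrite /update; case: eqP => [ptau|_]; [rewrite ptau ltnNge r2 in pr|apply: blow].
- move=> p; rewrite ltnS leq_eqVlt => /orP[/eqP/(pos_inj m_gt0)->//|pt pr].
  exact: dichotomy_agree (agreeW pt upd) (bdich _ pt pr).
move=> p; rewrite ltnS leq_eqVlt => /orP[/eqP/(pos_inj m_gt0)->|pt]; first by rewrite updtau.
by rewrite -upd //; apply: bP.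
Qed.

(* The top level [|xi| = 2r]: the differential condition only yields equations that are
   affine over [low] in the [a xi h], so any [low]-linear image of them is admissible. *)
Inductive top_graph b t : L -> E -> Prop :=
| TopLow f of low f : top_graph b t f (j f)
| TopGen p of msize_idx p.1 = (2 * r)%N & (pos p < t)%N : top_graph b t (A p) (b p)
| TopAdd y z y' z' of top_graph b t y z & top_graph b t y' z' : top_graph b t (y + y') (z + z')
| TopScale f y z of low f & top_graph b t y z : top_graph b t (f * y) (j f * z).

Definition top_functional b t : Prop := forall z, top_graph b t 0 z -> z = 0.

Lemma low_closed : subfield_closed low.
Proof. exact: gen_field_closed. Qed.

Lemma low_gen p : (msize_idx p.1 < 2 * r)%N -> low (A p).
Proof. by move=> pr; apply: gen_field_gen; exists p.1, p.2. Qed.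

Lemma low_const c : low (iota c).
Proof. exact: gen_field_const. Qed.

Lemma top_graph_before b t y z : (level_start m n (2 * r) <= t)%N ->
  (forall p, (msize_idx p.1 < 2 * r)%N -> b p = j (A p)) -> top_graph b t y z -> before b t z.
Proof.
move=> rt blow; have bf := before_closed b t; have [_ _ bD _ [bM _]] := bf.
have lowb f : low f -> before b t (j f).
  apply: (gen_field_le (subfield_preim j bf)) => [c|_ [xi [h [xir ->]]]]; first exact: before_const.
  have -> : j (a xi h) = b (xi, h) by rewrite blow.
  by apply: before_gen; apply: leq_trans rt; rewrite pos_lt_level.
elim=> [f /lowb//|p _ pt|{}y {}z y' z' _ h _ h'|f {}y {}z /lowb lf _ h].
- exact: before_gen.
- exact: bD.
exact: bM.
Qed.

(** Serves to show that [tau] is a separable leader as soon as [A tau] is a source of the graph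
    built before it. *)
Lemma top_graph_source b tau y z : msize_idx tau.1 = (2 * r)%N -> top_graph b (pos tau) y z ->
  gen_field iota (fun y => exists xi h, [/\ (msize_idx xi <= 2 * r)%N,
                                 tlt xi h tau.1 tau.2 & y = a xi h]) y.
Proof.
set S := (fun y : L => _) => tr; have [_ _ SD _ [SM _]] := gen_field_closed iota S.
have lowS f : low f -> gen_field iota S f.
  apply: gen_field_le => [|c|_ [xi [h [xir ->]]]]; [exact: gen_field_closed|exact: gen_field_const|].
  apply: gen_field_gen; exists xi, h; split=> //; first exact: ltnW.
  by rewrite (tlt_pos m_gt0 (xi, h)) pos_lt_msize //= tr.
elim=> [f /lowS//|p pr pt|{}y {}z y' z' _ h _ h'|f {}y {}z /lowS lf _ h].
- by apply: gen_field_gen; exists p.1, p.2; rewrite pr tlt_pos.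
- exact: SD.
exact: SM.
Qed.

(** Descending through smaller separable leaders ends at a minimal one, whose size the hypothesis
    [min_lead] bounds by [r]. *)
Lemma sep_leader_lead tau : (msize_idx tau.1 <= 2 * r)%N -> sep_leader r iota a tau.1 tau.2 ->
  lead tau.
Proof.
case: tau => sigma k /=; have [s] := ubnP (msize_idx sigma).
elim: s sigma => // s IHs sigma /ltnSE ss sr sl.
have [[rho [/andP[rs rns] rl]]|nmin] :=
    pselect (exists rho, mlt rho sigma /\ sep_leader r iota a rho k); last first.
  exists sigma; split=> //; first exact: mle_refl.
  by apply: (@min_lead sigma k sr); split.
have rhosize : (msize_idx rho < msize_idx sigma)%N.
  rewrite ltn_neqAle mle_msize // andbT; apply: contra rns => /eqP rsE.
  by apply/eqP/mle_msize_eq; rewrite ?rsE.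
have [rho' [/= rr' r'r r'l]] := IHs rho (leq_trans rhosize ss) (leq_trans (ltnW rhosize) sr) rl.
by exists rho'; split=> //; apply: mle_trans rs.
Qed.

(** Gaussian elimination, one unknown at a time: either [A tau] is an affine combination over [low]
    of earlier generators of size [2 * r], and its image is forced, or it is independent of them,
    and its image may be the free element [x (pos tau)]. *)
Lemma top_step b t : (level_start m n (2 * r) <= t < level_start m n (2 * r).+1)%N ->
  extends_low b t -> top_functional b t ->
  exists b', [/\ extends_low b' t.+1 & top_functional b' t.+1].
Proof.
move=> /andP[rt tr] bl bf; have [[tau tauE]|nt] := pselect (exists tau : index, pos tau = t); last first.
  have nt' p : pos p <> t by move=> pt; apply: nt; exists p.
  exists b; split; first exact: extends_low_skip.
  move=> z bz; apply: bf; elim: bz => [f lf|p pr|y z' y' z'' _ h _ h'|f y z' lf _ h].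
  - exact: TopLow.
  - by rewrite ltnS leq_eqVlt => /orP[/eqP/nt'//|]; apply: TopGen.
  - exact: TopAdd.
  exact: TopScale.
subst t; have tau2r : msize_idx tau.1 = (2 * r)%N.
  apply/eqP; rewrite eqn_leq -ltnS -(pos_lt_level m_gt0) tr /=.
  by rewrite leqNgt -(pos_lt_level m_gt0) -leqNgt.
have [blow _ _] := bl; have [l0 l1 lD lN [lM lV]] := low_closed.
have upd v := @agree_update b tau v.
have updtau v : update b tau v tau = v by rewrite /update eqxx.
have [[v btau]|nbtau] := pselect (exists v, top_graph b (pos tau) (A tau) v).
  exists (update b tau v); split.
    apply: extends_low_update; rewrite ?tau2r //; left; split; last exact: top_graph_before btau.
    (* An element of the field of earlier generators is a root of a linear, hence separable,
       polynomial over it; so [tau] is a separable leader. *)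
    apply: sep_leader_lead; rewrite ?tau2r //; apply: subfield_sep_algebraic; first exact: gen_field_closed.
    exact: top_graph_source btau.
  move=> z bz; apply: bf; elim: bz => [f lf|p pr|y z' y' z'' _ h _ h'|f y z' lf _ h].
  - exact: TopLow.
  - rewrite ltnS leq_eqVlt => /orP[/eqP/(pos_inj m_gt0)->|pt]; first by rewrite updtau.
    by rewrite -upd //; apply: TopGen.
  - exact: TopAdd.
  exact: TopScale.
exists (update b tau (x (pos tau))); split.
  by apply: extends_low_update; rewrite ?tau2r //; right.
set b' := update _ _ _.
(* The new graph is the old one plus the [low]-multiples of the single pair
   [(A tau, x (pos tau))]. *)
have split_graph y z : top_graph b' (pos tau).+1 y z -> exists y0 z0 f,
    [/\ top_graph b (pos tau) y0 z0, low f, y = y0 + f * A tau & z = z0 + j f * x (pos tau)].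
  elim=> [f lf|p pr|{}y {}z y' z' _ [y0 [z0 [f [h lf -> ->]]]] _ [y1 [z1 [g [h' lg -> ->]]]]
    |f {}y {}z lf _ [y0 [z0 [g [h lg -> ->]]]]].
  - by exists f, (j f), 0; rewrite rmorph0 !mul0r !addr0; split=> //; apply: TopLow.
  - rewrite ltnS leq_eqVlt => /orP[/eqP/(pos_inj m_gt0)->|pt].
      exists 0, 0, 1; rewrite /b' updtau rmorph1 !mul1r !add0r.
      by split=> //; rewrite -(rmorph0 j); apply: TopLow.
    exists (A p), (b p), 0; rewrite rmorph0 !mul0r !addr0 /b' -upd //; split=> //; exact: TopGen.
  - exists (y0 + y1), (z0 + z1), (f + g); rewrite rmorphD !mulrDl.
    by split; [apply: TopAdd|apply: lD|rewrite addrACA|rewrite addrACA].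
  exists (f * y0), (j f * z0), (f * g); rewrite rmorphM !mulrDr !mulrA.
  by split=> //; [apply: TopScale|apply: lM].
move=> z /split_graph[y0 [z0 [f [h lf /esym y0f ->]]]].
have [f0|f0] := eqVneq f 0.
  by move: y0f h; rewrite f0 rmorph0 !mul0r !addr0 => -> /bf.
(* A nonzero coefficient [f] could be inverted in [low], which would make [A tau] a source of the
   old graph. *)
case: nbtau; exists (j (- f^-1) * z0).
have -> : A tau = - f^-1 * y0.
  by move/eqP: y0f; rewrite addr_eq0 => /eqP->; rewrite mulrNN mulKf.
by apply: TopScale h; apply: lN; apply: lV.
Qed.

Lemma top_stage : exists b,
  extends_low b (level_start m n (2 * r).+1) /\ top_functional b (level_start m n (2 * r).+1).
Proof.
have le := level_start_mono m n (leqnSn (2 * r)).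
suff H k : (level_start m n (2 * r) + k <= level_start m n (2 * r).+1)%N -> exists b,
    extends_low b (level_start m n (2 * r) + k) /\ top_functional b (level_start m n (2 * r) + k).
  by have := H (level_start m n (2 * r).+1 - level_start m n (2 * r))%N; rewrite subnKC //; apply.
elim: k => [_|k IHk]; last first.
  rewrite addnS => kt; have [b [bl bf]] := IHk (ltnW kt).
  by have [|b' [bl' bf']] := top_step _ bl bf; [rewrite leq_addr|exists b'].
(* Start with the image of [a] itself: the top graph is then part of the graph of [j], and no index
   of size at least [2 * r] has been reached yet. *)
rewrite addn0; exists (fun p => j (A p)); split; first split=> // p.
- by rewrite pos_lt_level // ltnNge => /negP.
- by move=> _; apply: P_mono (P0 _).
move=> z; suff H y : top_graph (fun p => j (A p)) (level_start m n (2 * r)) y z -> z = j y.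
  by move/H; rewrite rmorph0.
elim=> [//|//|{}y {}z y' z' _ -> _ ->|f {}y {}z _ _ ->]; first by rewrite rmorphD.
by rewrite rmorphM.
Qed.

(** The derivation on [low] given by [base_functional] takes values that are affine in the
    generators of size [2 * r]. Following it by the top graph, which is linear over [low], gives a
    functional dual field [R] containing all the prescribed pairs. *)
Lemma top_stage_functional b i : let t := level_start m n (2 * r).+1 in
  extends_low b t -> top_functional b t -> functional (stage b t i).
Proof.
move=> t [blow _ _] bf; pose G := deriv_gen d iota A (fun p => (msize_idx p.1 < 2 * r)%N) i.
have Gf : functional (dual_closure G) by apply: base_functional.
have [[G1 GD GN GM] GV] := dual_closure_field G.
have [l0 l1 lD lN [lM lV]] := low_closed.
have topN y z : top_graph b t y z -> top_graph b t (- y) (- z).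
  by rewrite -mulN1r -[- z]mulN1r -(rmorphN1 j); apply: TopScale; apply: lN.
pose R y z := exists y0 z0,
  [/\ y = j y0, low y0, dual_closure G y0 z0 & top_graph b t z0 z].
have Rf : dual_field R.
  split; [split|].
  - exists 1, 0; rewrite rmorph1; split=> //.
    by rewrite -[X in top_graph _ _ _ X](rmorph0 j); apply: TopLow.
  - move=> _ z _ z' [y0 [z0 [-> ly Gy Tz]]] [y1 [z1 [-> ly' Gy' Tz']]].
    by exists (y0 + y1), (z0 + z1); rewrite rmorphD; split; auto; apply: TopAdd.
  - move=> _ z [y0 [z0 [-> ly Gy Tz]]].
    by exists (- y0), (- z0); rewrite rmorphN; split; auto.
  - move=> _ z _ z' [y0 [z0 [-> ly Gy Tz]]] [y1 [z1 [-> ly' Gy' Tz']]].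
    exists (y0 * y1), (z0 * y1 + y0 * z1); rewrite rmorphM; split; auto.
    by rewrite mulrC [z * _]mulrC; apply: TopAdd; apply: TopScale.
  move=> _ z [y0 [z0 [-> ly Gy Tz]]].
  exists y0^-1, (- z0 * y0^-1 * y0^-1); rewrite fmorphV; split; auto.
  rewrite -fmorphV -!mulrA -rmorphM [- z0 * _]mulrC [- z * _]mulrC.
  by apply: TopScale; auto.
have GR y z : stage_gen b t i y z -> R y z.
  case=> [[c [-> ->]]|[p [pt -> ->]]].
    exists (iota c), (iota (d i c)); split=> [|||].
    + by [].
    + exact: low_const.
    + by apply: dual_closure_gen; left; exists c.
    by apply: TopLow; apply: low_const.
  have sr : (msize_idx (shift p i).1 < (2 * r).+1)%N by rewrite -(pos_lt_level m_gt0).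
  have pr : (msize_idx p.1 < 2 * r)%N by move: sr; rewrite msize_add_eps.
  exists (A p), (A (shift p i)); split; [exact: blow|exact: low_gen| |].
    by apply: dual_closure_gen; right; exists p.
  move: sr; rewrite ltnS leq_eqVlt => /predU1P[sE|sr]; first exact: TopGen.
  by rewrite (blow (shift p i) sr); apply: TopLow; apply: low_gen.
move=> z /(dual_closure_le Rf GR)[y0 [z0 [/esym/eqP]]]; rewrite fmorph_eq0 => /eqP-> _ /Gf->.
exact: bf.
Qed.

(** * Generators of size above [2 * r] *)

Definition good b t : Prop := extends_low b t /\ forall i, functional (stage b t i).

(** Induction on the size, upwards from the leader [rho]. At [rho] all values involved are images
    under [j], since [r < 2 * r]. Further up, [b p] is the derivative of a separably algebraic
    element, so by [sep_algebraic_value] it even lies in the field generated before it. *)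
Lemma lead_sep_algebraic b t p : good b t -> (pos p < t)%N -> lead p ->
  sep_algebraic_over (before b (pos p)) (b p).
Proof.
move=> [[blow _ _] bfun] + [rho [+ rhor rhol]]; case: p rhol => sigma k /= rhol.
have rr : (r < 2 * r)%N by rewrite ltn_Pmull.
have [s] := ubnP (msize_idx sigma); elim: s sigma => // s IHs sigma /ltnSE ss pt rs.
case: (ltnP (msize_idx rho) (msize_idx sigma)) => [rhos|]; last first.
  move=> /(mle_msize_eq rs) <-; rewrite blow ?(leq_ltn_trans rhor) //.
  apply: sep_algebraic_map rhol; apply: gen_field_le => [|c|_ [xi [h [xir xirho ->]]]].
  - exact: (subfield_preim j (before_closed _ _)).
  - exact: before_const.
  have xip : (pos (xi, h) < pos (rho, k))%N by rewrite -(tlt_pos m_gt0 (xi, h) (rho, k)).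
  have xis : (msize_idx xi <= msize_idx rho)%N.
    rewrite leqNgt; apply/negP => h1; have := @pos_lt_msize _ _ m_gt0 (rho, k) (xi, h) h1.
    by rewrite ltnNge (ltnW xip).
  have -> : j (a xi h) = b (xi, h) by rewrite blow // (leq_ltn_trans xis) // (leq_ltn_trans rhor).
  exact: before_gen.
have [i [sigma' [sE rs']]] := mle_pred rs rhos.
have shE : shift (sigma', k) i = (sigma, k) by rewrite /shift sE.
have s'lt : (pos (sigma', k) < pos (sigma, k))%N by rewrite -shE pos_ltn_shift.
have s's : (msize_idx sigma' < s)%N by move: ss; rewrite -sE msize_add_eps.
have s'sep := IHs sigma' s's (ltn_trans s'lt pt) rs'.
have [Rr _] := stage_field b t i.
apply: subfield_sep_algebraic; first exact: before_closed.
apply: (sep_algebraic_value Rr (bfun i) (before_closed b (pos (sigma, k))) _ s'sep).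
- move=> y yb; split; first exact: before_mono (ltnW s'lt) yb.
  have [z] := stage_total i yb; rewrite shE => yz; exists z; last exact: stage_range yz.
  by apply: stage_le yz => //; exact: ltnW.
- exact: before_gen.
by rewrite -shE; apply: stage_shift; rewrite shE.
Qed.

Lemma not_lead_transcendental b t p : good b t -> (pos p < t)%N ->
  (2 * r <= msize_idx p.1)%N -> ~ lead p -> transcendental_over (before b (pos p)) (b p).
Proof. by move=> [[_ bd _] _] pt pr nl; case: (bd p pt pr) => // -[]. Qed.

Lemma lead_before b t p : good b t -> (pos p < t)%N ->
  (2 * r <= msize_idx p.1)%N -> lead p -> before b (pos p) (b p).
Proof.
move=> bg pt pr pl; have sp := lead_sep_algebraic bg pt pl; case: bg => -[_ bd _] _.
by case: (bd p pt pr) => [[]//|/(sep_algebraic_not_transcendental sp)].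
Qed.

(** Here [t] is the position of the double shift of [p], so no value of [b] at that index enters.
    For [q] before [p] the double shift of [q] precedes [t], and the commutator sends [b q] to 0; it
    also kills [K], hence the separably algebraic [b p]. *)
Lemma stage_commute b p i i' v w : let t := pos (shift (shift p i') i) in
  good b t -> lead p ->
  stage b t i (b (shift p i')) v -> stage b t i' (b (shift p i)) w -> v = w.
Proof.
move=> t bg pl bv bw; have [_ bfun] := bg; have [_ dcomm] := dd.
have Cfun := dual_commutator_functional (bfun i) (bfun i').
have Cfield := dual_commutator_field (stage_field b t i) (stage_field b t i').
have tE : t = pos (shift (shift p i) i') by rewrite /t shift_comm.
have lt1 : (pos (shift p i') < t)%N by apply: pos_ltn_shift.
have lt2 : (pos (shift p i) < t)%N by rewrite tE; apply: pos_ltn_shift.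
have pt : (pos p < t)%N by apply: ltn_trans lt1; apply: pos_ltn_shift.
apply/eqP; rewrite -subr_eq0; apply/eqP.
apply: (sep_algebraic_constant Cfield.1 Cfun _ (lead_sep_algebraic bg pt pl)); last first.
  by exists (b (shift p i)), (b (shift p i')), v, w; split=> //; apply: stage_shift.
apply: gen_field_le => [|c|_ [q [qp ->]]]; first exact: dual_constants_closed.
  exists (iK (d i c)), (iK (d i' c)), (iK (d i (d i' c))), (iK (d i' (d i c))).
  by split; [exact: stage_const..|rewrite dcomm subrr].
exists (b (shift q i)), (b (shift q i')), (b (shift (shift q i') i)), (b (shift (shift q i) i')).
split; last by rewrite shift_comm subrr.
- by apply: stage_shift; apply: ltn_trans lt2; rewrite pos_shift.
- by apply: stage_shift; apply: ltn_trans lt1; rewrite pos_shift.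
- by apply: stage_shift; rewrite !pos_shift.
by apply: stage_shift; rewrite tE !pos_shift.
Qed.

(** With one leader [rho] below both predecessors, either these coincide or they have a common
    predecessor above [rho], where the commutator argument applies. *)
Lemma stage_coherent_at b (s s' : index) i i' rho v w : let t := pos (shift s i) in
  good b t -> shift s i = shift s' i' ->
  mle rho s.1 -> mle rho s'.1 -> (msize_idx rho <= r)%N -> sep_leader r iota a rho s.2 ->
  stage b t i (b s) v -> stage b t i' (b s') w -> v = w.
Proof.
move=> t bg ss' rs rs' rr rl; have [ii'|ii'] := eqVneq i i'.
  rewrite -ii' in ss' *; rewrite -(shift_inj ss'); have [_ bfun] := bg.
  by apply: dual_functional; [case: (stage_field b t i)|apply: bfun].
have [p [sE s'E rp]] := shift_diamond ii' ss' rs rs'.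
move: bg; rewrite /t sE s'E => bg; apply: (stage_commute bg).
by exists rho; split=> //; rewrite -[p.2]/((shift p i').2) -sE.
Qed.

Lemma stage_coherent b (s s' : index) i i' v w : let t := pos (shift s i) in
  good b t -> (2 * r < msize_idx (shift s i).1)%N -> shift s i = shift s' i' ->
  lead s -> lead s' -> stage b t i (b s) v -> stage b t i' (b s') w -> v = w.
Proof.
move=> t bg tr ss' [rho [rs rr rl]] [rho' [rs' rr' rl']] bv bw.
have s2 : s.2 = s'.2 by have [] := ss'.
have le_s : mle rho (shift s i).1 by apply: mle_trans rs (mle_add_eps _ _).
have le_s' : mle rho' (shift s i).1 by rewrite ss'; apply: mle_trans rs' (mle_add_eps _ _).
have [||k [sigma [sigmaE jsigma]]] := @mle_pred m (mjoin rho rho') (shift s i).1.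
- exact: mjoin_le.
- apply: leq_ltn_trans (msize_join _ _) (leq_ltn_trans _ tr).
  by rewrite mul2n -addnn leq_add.
pose p : index := (sigma, s.2).
have pE : shift p k = shift s i by rewrite /shift /p /= sigmaE.
have rp : mle rho p.1 := mle_trans (mle_joinl _ _) jsigma.
have rp' : mle rho' p.1 := mle_trans (mle_joinr _ _) jsigma.
have pt : (pos p < t)%N by rewrite /t -pE; apply: pos_ltn_shift.
(* Size at least [2 * r] lets [lead_before] apply to [p], so that its derivative [u] in direction
   [k] is defined. Then [v = u] follows through [rho], and [w = u] through [rho']. *)
have pr : (2 * r <= msize_idx p.1)%N.
  by move: tr; rewrite -pE /= msize_add_eps ltnS.
have pl : lead p by exists rho.
have [u bu] := stage_total k (lead_before bg pt pr pl).
rewrite pE in bu.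
have -> : v = u.
  by apply: (stage_coherent_at bg _ rs rp rr rl bv bu); rewrite pE.
have bg' : good b (pos (shift p k)) by rewrite pE.
have rlp : sep_leader r iota a rho' p.2 by rewrite /p /= s2.
by apply: (stage_coherent_at (i' := i') bg' _ rp' rs' rr' rlp); rewrite pE.
Qed.

Lemma good_step b t : (level_start m n (2 * r).+1 <= t)%N -> good b t ->
  exists b', agree b b' t /\ good b' t.+1.
Proof.
move=> rt bg; have [bl bfun] := bg.
have [[tau tauE]|nt] := pselect (exists tau : index, pos tau = t); last first.
  have nt' p : pos p <> t by move=> pt; apply: nt; exists p.
  exists b; split=> //; split=> [|i z bz]; first exact: extends_low_skip.
  apply: (bfun i); move: bz; apply: dual_closure_mono => y {}z.
  by case/stage_gen_next=> // -[s [/nt']].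
subst t; have taur : (2 * r < msize_idx tau.1)%N.
  by rewrite ltnNge -ltnS -(pos_lt_level m_gt0) -leqNgt.
have predr (s : index) i : shift s i = tau -> (2 * r <= msize_idx s.1)%N.
  by move=> sE; move: taur; rewrite -sE msize_add_eps.
have predt (s : index) i : shift s i = tau -> (pos s < pos tau)%N.
  by move=> <-; apply: pos_ltn_shift.
have total (s : index) i : shift s i = tau -> lead s -> exists v, stage b (pos tau) i (b s) v.
  move=> sE sl; have := lead_before bg (predt _ _ sE) (predr _ _ sE) sl.
  by move=> /(stage_total i); rewrite sE.
(* One value [v] serves all lead predecessors of [tau]: the derivative of any one of them, by
   coherence, or the free element if there is none. *)
have [v [vtau vcoh]] : exists v, ((lead tau /\ before b (pos tau) v) \/ v = x (pos tau)) /\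
    forall (s : index) i, shift s i = tau -> lead s -> stage b (pos tau) i (b s) v.
  have [[s [i [sE sl]]]|nl] := pselect (exists (s : index) i, shift s i = tau /\ lead s).
    have [v bv] := total s i sE sl; exists v; split.
      left; split; last exact: stage_range bv.
      have [rho [rs rr rl]] := sl; exists rho; rewrite -sE; split=> //.
      exact: mle_trans rs (mle_add_eps _ _).
    move=> s' i' s'E sl'; have [w bw] := total s' i' s'E sl'.
    suff -> : v = w by [].
    have bg' : good b (pos (shift s i)) by rewrite sE.
    by apply: (stage_coherent (i' := i') bg' _ _ sl sl'); rewrite ?sE // s'E.
  exists (x (pos tau)); split; first by right.
  by move=> s i sE sl; case: nl; exists s, i.
have upd := @agree_update b tau v.
exists (update b tau v); split=> //; split=> [|i]; first exact: extends_low_update (ltnW taur) vtau.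
have upd' : agree (update b tau v) b (pos tau) by apply: agree_sym.
(* In a fixed direction [i] the only new pair is [(b s, v)], where [s] is the predecessor of [tau]
   in that direction, if it exists. *)
have gen_le y z : stage_gen (update b tau v) (pos tau).+1 i y z ->
    stage_gen b (pos tau) i y z \/ exists s, [/\ shift s i = tau, y = b s & z = v].
  case/stage_gen_next => [/(stage_gen_le (leqnn _) upd')|[s [/(pos_inj m_gt0) sE -> ->]]].
    by left.
  by right; exists s; rewrite (upd' s (predt _ _ sE)) sE /update eqxx.
have [[s sE]|ns] := pselect (exists s, shift s i = tau); last first.
  move=> z bz; apply: (bfun i); move: bz; apply: dual_closure_mono => y {}z /gen_le[//|[s [sE _ _]]].
  by case: ns; exists s.
(* If [s] is lead, the new pair already belongs to the old stage. Otherwise [b s] is transcendental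
   over the domain of the old stage and may be given any derivative. *)
have [sl|snl] := pselect (lead s).
  move=> z bz; apply: (bfun i); move: bz; apply: dual_closure_le => [|y {}z /gen_le[|]].
  - exact: stage_field.
  - exact: dual_closure_gen.
  case=> s' [s'E -> ->]; apply: vcoh => //.
  by have <- : s = s' by apply: (@shift_inj _ _ i); rewrite sE.
have str : transcendental_over (dual_dom (stage b (pos tau) i)) (b s).
  apply: transcendental_overW (not_lead_transcendental bg (predt _ _ sE) (predr _ _ sE) snl).
  by move=> y [z]; rewrite -sE; apply: stage_dom.
move=> z bz; apply: (transcendental_extend (v := v) (bfun i) str).
move: bz; apply: dual_closure_mono => y {}z /gen_le[|[s' [s'E -> ->]]]; first by left.
by right; split=> //; congr b; apply: (@shift_inj _ _ i); rewrite sE.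
Qed.

(** * The limit of the partial families *)

Lemma good_family : exists b : index -> E,
  (forall p, (msize_idx p.1 < 2 * r)%N -> b p = j (A p)) /\
  forall i, functional (dual_closure (deriv_gen d iK b (fun=> True) i)).
Proof.
pose t0 := level_start m n (2 * r).+1.
have [b0 bg0] : exists b, good b t0.
  by have [b [bl bf]] := top_stage; exists b; split=> // i; apply: top_stage_functional.
have step (kb : nat * (index -> E)) : exists b', good kb.2 (t0 + kb.1) ->
    agree kb.2 b' (t0 + kb.1) /\ good b' (t0 + kb.1).+1.
  case: (pselect (good kb.2 (t0 + kb.1))) => [/(good_step (leq_addr _ _))[b' ?]|?].
    by exists b'.
  by exists kb.2.
have [f fP] := choice step; pose B := fix B k := if k is k'.+1 then f (k', B k') else b0.
have Bg k : good (B k) (t0 + k).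
  by elim: k => [|k IHk]; rewrite ?addn0 // addnS; case: (fP (k, B k) IHk).
have BS k : agree (B k) (B k.+1) (t0 + k) by case: (fP (k, B k) (Bg k)).
have Bagree k l : (k <= l)%N -> agree (B k) (B l) (t0 + k).
  move=> /subnK <-; elim: (l - k)%N => // u IHu p pt; rewrite IHu // addSn.
  by apply: BS; rewrite (leq_trans pt) // leq_add2l leq_addl.
(* Each value stabilises: the families [B k] with [k > pos p] all agree at [p]. *)
pose b p := B (pos p).+1 p.
have Bb k : agree (B k) b (t0 + k).
  move=> p pt; rewrite /b; case: (leqP k (pos p).+1) => [/Bagree->//|/ltnW/Bagree->//].
  by rewrite addnS ltnS leq_addl.
exists b; split=> [p pr|i z]; first by have [[blow _ _] _] := Bg (pos p).+1; apply: blow.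
(* The stages increase with [k], so their union is a dual field, and a pair [(0, z)] in it already
   lies in a single functional stage. *)
pose R y z := exists k, stage b k i y z.
have bmono k l y z' : (k <= l)%N -> stage b k i y z' -> stage b l i y z'.
  by move=> kl; apply: stage_le.
have Rf : dual_field R.
  split; [split|].
  - by exists 0%N; case: (stage_field b 0 i) => [[]].
  - move=> y1 z1 y2 z2 [k yk] [l yl]; exists (maxn k l).
    case: (stage_field b (maxn k l) i) => [[_ RD _ _] _]; apply: RD.
      exact: bmono (leq_maxl _ _) yk.
    exact: bmono (leq_maxr _ _) yl.
  - by move=> y1 z1 [k yk]; exists k; case: (stage_field b k i) => [[_ _ RN _] _]; apply: RN.
  - move=> y1 z1 y2 z2 [k yk] [l yl]; exists (maxn k l).
    case: (stage_field b (maxn k l) i) => [[_ _ _ RM] _]; apply: RM.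
      exact: bmono (leq_maxl _ _) yk.
    exact: bmono (leq_maxr _ _) yl.
  by move=> y1 z1 [k yk]; exists k; case: (stage_field b k i) => [_ RV]; apply: RV.
have GR y z' : deriv_gen d iK b (fun=> True) i y z' -> R y z'.
  case=> [[c [-> ->]]|[p [_ -> ->]]]; first by exists 0%N; apply: stage_const.
  by exists (pos (shift p i)).+1; apply: stage_shift.
move=> /(dual_closure_le Rf GR)[k bk]; have [_ /(_ i)] := Bg k; apply.
by apply: stage_le bk; rewrite ?leq_addl // => p pk; apply/esym/Bb/(leq_trans pk)/leq_addl.
Qed.

End Prolongation.

(** * The differential field *)

Section SubfieldType.
Variables (E : fieldType) (P : E -> Prop) (Pc : subfield_closed P).

(** The closure proof is an argument so that the algebraic closure instance can be attached to the
    predicate. *)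
Definition subfield_pred of subfield_closed P : {pred E} := fun y => `[< P y >].

Fact subfield_pred_divring : divring_closed (subfield_pred Pc).
Proof.
have [_ P1 PD PN [PM PV]] := Pc; split; first exact/asboolP.
  by move=> y z /asboolP Py /asboolP Pz; apply/asboolP; apply: PD => //; apply: PN.
by move=> y z /asboolP Py /asboolP Pz; apply/asboolP; apply: PM => //; apply: PV.
Qed.
HB.instance Definition _ :=
  GRing.isDivringClosed.Build E (subfield_pred Pc) subfield_pred_divring.

Record subfield_type :=
  SubfieldElt { subfield_val :> E; _ : subfield_val \in subfield_pred Pc }.
HB.instance Definition _ := [isSub for subfield_val].
HB.instance Definition _ := [Choice of subfield_type by <:].
HB.instance Definition _ := [SubChoice_isSubIntegralDomain of subfield_type by <:].
HB.instance Definition _ := [SubIntegralDomain_isSubField of subfield_type by <:].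

Lemma exists_subfield_type : exists (M : fieldType) (e : {rmorphism M -> E}),
  forall y, P y <-> exists z, e z = y.
Proof.
exists subfield_type, (val : {rmorphism subfield_type -> E}) => y.
split=> [Py|[z <-]]; last exact: (asboolW (valP z)).
by exists (SubfieldElt (asboolT Py : y \in subfield_pred Pc)).
Qed.

End SubfieldType.

Lemma rmorphism_lift (K E M : fieldType) (e : {rmorphism M -> E}) (g : {rmorphism K -> E}) :
  (forall c, exists z, e z = g c) -> exists g' : {rmorphism K -> M}, forall c, e (g' c) = g c.
Proof.
move=> /choice[f fP]; have einj := fmorph_inj e.
have fz : zmod_morphism f by move=> x y; apply: einj; rewrite rmorphB !fP rmorphB.
have fm : monoid_morphism f.
  by split=> [|x y]; apply: einj; rewrite ?rmorph1 ?rmorphM !fP ?rmorph1 ?rmorphM.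
pose f1 : {additive K -> M} := HB.pack f (GRing.isZmodMorphism.Build K M f fz).
pose f2 : {rmorphism K -> M} := HB.pack f f1 (GRing.isMonoidMorphism.Build K M f fm).
by exists f2.
Qed.

Theorem theorem4p3 (m : nat) (K : fieldType) (d : 'I_m -> K -> K)
    (r n : nat) (L : fieldType) (iota : {rmorphism K -> L}) (a : mindex m -> 'I_n -> L) :
  (0 < m)%N -> commuting_derivations d -> (0 < r)%N -> (0 < n)%N ->
  differential_condition r d iota a ->
  (forall (sigma : mindex m) (k : 'I_n), (msize_idx sigma <= 2 * r)%N ->
     min_sep_leader r iota a sigma k -> (msize_idx sigma <= r)%N) ->
  exists (M : fieldType) (iM : {rmorphism K -> M}) (D : 'I_m -> M -> M) (phi : L -> M),
    [/\ commuting_derivations D,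
        (forall i c, D i (iM c) = iM (d i c)),
        [/\
        (forall x y, low_field r iota a x -> low_field r iota a y ->
           phi (x + y) = phi x + phi y /\ phi (x * y) = phi x * phi y),
        phi 1 = 1 &
        (forall c, phi (iota c) = iM c)] &
        (forall (i : 'I_m) (k : 'I_n) (sigma : mindex m),
           (msize_idx sigma + 1 < 2 * r)%N ->
           D i (phi (a sigma k)) = phi (a (add_eps sigma i) k))].
Proof.
move=> m_gt0 dd r_gt0 n_gt0 dc min_lead.
have [E [j [P [x [P_closed P_mono P0 Px x_trans]]]]] := exists_transcendence_tower L.
have [b [blow bfun]] :=
  good_family m_gt0 dd r_gt0 n_gt0 dc min_lead P_closed P_mono P0 Px x_trans.
pose iK : {rmorphism K -> E} := j \o iota.
pose F := gen_field iK (fun y => exists p, y = b p).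
have Fc : subfield_closed F by apply: gen_field_closed.
have FK c : F (iK c) by apply: gen_field_const.
have Fb p : F (b p) by apply: gen_field_gen; exists p.
pose R i := dual_closure (deriv_gen d iK b (fun=> True) i).
have Rf i : dual_field (R i) by apply: dual_closure_field.
have [M [e eF]] := exists_subfield_type Fc.
have einj : injective e := fmorph_inj e.
have RK i c : R i (iK c) (iK (d i c)) by apply: dual_closure_gen; left; exists c.
have Rb i p : R i (b p) (b (shift p i)) by apply: dual_closure_gen; right; exists p.
(* [R i] is defined on all of [F] and takes values in [F], because both hold for the generators; it
   therefore induces a map on [M]. *)
have [D DP] : exists D : 'I_m * M -> M, forall iy, R iy.1 (e iy.2) (e (D iy)).
  suff /choice[D DP] (iy : 'I_m * M) : exists z, R iy.1 (e iy.2) (e z) by exists D.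
  case: iy => i y /=; have [z Ryz] : dual_dom (R i) (e y).
    have : F (e y) by apply/eF; exists y.
    apply: gen_field_le => [|c|_ [p ->]]; first exact: dual_dom_closed.
      by exists (iK (d i c)).
    by exists (b (shift p i)).
  have [_ /eF[z' z'E]] : F (e y) /\ F z.
    apply: (dual_closure_range Fc _ Ryz) => y' z' [[c [-> ->]]|[p [_ -> ->]]]; split=> //.
  by exists z'; rewrite z'E.
have DE i y z : R i (e y) (e z) -> D (i, y) = z.
  move=> Ryz; apply: einj; have [Rr _] := Rf i.
  exact: (dual_functional Rr (bfun i) (DP (i, y)) Ryz).
have [iM iME] : exists iM : {rmorphism K -> M}, forall c, e (iM c) = iK c.
  by apply: rmorphism_lift => c; apply/eF.
(* The map [phi] is [j] read in [M] where [j y] lies in [F], which includes [low_field]; elsewhere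
   it takes the default value 0. *)
have [phi phiE] : exists phi : L -> M, forall y, F (j y) -> e (phi y) = j y.
  suff /choice[phi phiE] (y : L) : exists z, F (j y) -> e z = j y by exists phi.
  by case: (pselect (F (j y))) => [/eF[z zE]|?]; [exists z|exists 0].
have lowF : forall y, low_field r iota a y -> F (j y).
  apply: (gen_field_le (subfield_preim j Fc)) => [//|_ [xi [h [xir ->]]]].
  by rewrite -[a xi h]/(a (xi, h).1 (xi, h).2) -blow.
have phib p : (msize_idx p.1 < 2 * r)%N -> e (phi (a p.1 p.2)) = b p.
  by move=> pr; rewrite phiE -blow.
exists M, iM, (fun i y => D (i, y)), phi; split.
- split=> [i|i i' y].
    have [[R1 RD RN RM] _] := Rf i; split=> y z; apply: DE.
      by rewrite !rmorphD; apply: RD; [apply: (DP (i, y))|apply: (DP (i, z))].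
    by rewrite rmorphD !rmorphM; apply: RM; [apply: (DP (i, y))|apply: (DP (i, z))].
  have Cfun := dual_commutator_functional (bfun i) (bfun i').
  have Cf := dual_commutator_field (Rf i) (Rf i').
  (* The constants of the commutator form a subfield containing [K] and every [b p], hence all of
     [F]. *)
  have Cy0 : dual_commutator (R i) (R i') (e y) 0.
    have : F (e y) by apply/eF; exists y.
    apply: (@gen_field_le _ _ iK _ (fun y => dual_commutator (R i) (R i') y 0)) => [|c|_ [p ->]].
      exact: dual_constants_closed.
      exists (iK (d i c)), (iK (d i' c)), (iK (d i (d i' c))), (iK (d i' (d i c))).
      by split=> //; case: dd => _ ->; rewrite subrr.
    exists (b (shift p i)), (b (shift p i')), (b (shift (shift p i') i)), (b (shift (shift p i) i')).
    by split=> //; rewrite shift_comm subrr.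
  apply/einj/eqP; rewrite -subr_eq0; apply/eqP.
  apply: (dual_functional Cf.1 Cfun _ Cy0).
  exists (e (D (i, y))), (e (D (i', y))), (e (D (i, D (i', y)))), (e (D (i', D (i, y)))).
  split=> //; [exact: (DP (i, y))|exact: (DP (i', y))| |].
    exact: (DP (i, D (i', y))).
  exact: (DP (i', D (i, y))).
- by move=> i c; apply: DE; rewrite !iME.
- split=> [y z ly lz||c].
  + have [_ _ lD _ [lM _]] := gen_field_closed iota
        (fun y : L => exists xi h, (msize_idx xi < 2 * r)%N /\ y = a xi h).
    split; apply: einj; rewrite ?rmorphD ?rmorphM !phiE ?rmorphD ?rmorphM //; try exact: lowF.
      by rewrite -rmorphD; apply: lowF; apply: lD.
    by rewrite -rmorphM; apply: lowF; apply: lM.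
  + by apply: einj; rewrite phiE ?rmorph1 //; case: Fc.
  by apply: einj; rewrite phiE ?iME; last exact: FK.
move=> i k sigma sr; apply: DE.
have s1 : (msize_idx sigma < 2 * r)%N by rewrite -ltnS -addn1 ltnW // ltnW.
rewrite (phib (sigma, k) s1) (phib (shift (sigma, k) i)) //.
by rewrite msize_add_eps -addn1.
Qed.
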